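(* Let $\mathcal{H}$ be a separable Hilbert space with orthonormal basis $\{e_i\}_{i\in\mathbb{Z}}$, let $\mathcal{A}=B_0(\mathcal{H})$ be the $C^*$-algebra of compact operators on $\mathcal{H}$, let $U$ be a unitary operator on $\mathcal{H}$, let $W=(W_j)_{j\in\mathbb{Z}}$ be a uniformly bounded sequence of invertible operators in $B(\mathcal{H})$ such that $(W_j^{-1})_{j\in\mathbb{Z}}$ is also uniformly bounded, and let $T_{U,W}$ be the operator on $\ell_2(\mathcal{A})$ given by $(T_{U,W}(x))_n=W_nx_{n-1}U$ for $n\in\mathbb{Z}$. Let $\mathcal{F}$ be a proper, finitely invariant Furstenberg family, let $(t_n)_n$ be an unbounded sequence of nonnegative integers, and put $T_{U,W,n}:=T_{U,W}^{t_n}$ for all $n\in\mathbb{N}$. Then the following assertions are equivalent. (1) $(T_{U,W,n})_n$ is $\mathcal{F}$-transitive. (2) For every $J,m\in\mathbb{N}$ there exist, for all $j\in[J]$, sequences $\{D^{(n)}_j\}_{n\in\mathbb{N}}$ and $\{G^{(n)}_j\}_{n\in\mathbb{N}}$ of operators in $B_0(\mathcal{H})$ such that the quadruples $$\left(\|D^{(n)}_j-P_m\|,\ \|G^{(n)}_j-P_m\|,\ \|W_{j+t_n}W_{j+t_n-1}\cdots W_{j+1}D^{(n)}_j\|,\ \|W^{-1}_{j-t_n+1}W^{-1}_{j-t_n+2}\cdots W^{-1}_{j}G^{(n)}_j\|\right)$$ uniformly $\mathcal{F}$-converge to $(0,0,0,0)$ as $n\to\infty$, for $j\in[J]$.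
   Context: $B(\mathcal{H})$ is the $C^*$-algebra of bounded linear operators on $\mathcal{H}$. $\ell_2(\mathcal{A})$ is the standard right Hilbert $\mathcal{A}$-module of sequences $x=(x_j)_{j\in\mathbb{Z}}$ in $\mathcal{A}$ such that $\sum_{j}x_j^*x_j$ converges in norm in $\mathcal{A}$, with norm $\|x\|=\|\sum_j x_j^*x_j\|^{1/2}$. For $J,m\in\mathbb{N}$, $[J]=\{-J,\dots,J\}$, $L_m=\mathrm{span}\{e_{-m},\dots,e_m\}$, and $P_m$ is the orthogonal projection of $\mathcal{H}$ onto $L_m$. Products of weights over an empty index range ($t_n=0$) are the identity. A Furstenberg family is a collection $\mathcal{F}$ of subsets of $\mathbb{N}_0=\mathbb{N}\cup\{0\}$ that is hereditary upward ($A\in\mathcal{F}$, $A\subset B$ imply $B\in\mathcal{F}$). It is proper if it is non-empty and does not contain the empty set, and finitely invariant if $A\setminus[0,n]\in\mathcal{F}$ for all $A\in\mathcal{F}$ and $n\ge0$. A sequence $(T_n)_n$ of continuous linear operators on a separable infinite-dimensional Banach space $X$ is $\mathcal{F}$-transitive ($\mathcal{F}$ proper) if for all non-empty open $V_1,V_2\subset X$ the set $\{n: T_n(V_1)\cap V_2\ne\emptyset\}$ belongs to $\mathcal{F}$. Uniform $\mathcal{F}$-convergence: given a set $I$, separable Banach spaces $X_i$ ($i\in I$), sequences $\{x^{(i)}_n\}_n\subset X_i$ and $x^{(i)}\in X_i$, one says $x^{(i)}_n$ uniformly $\mathcal{F}$-converges to $x^{(i)}$ as $n\to\infty$ for $i\in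 I$ if for every choice of neighborhoods $V_i\subset X_i$ of $x^{(i)}$, $i\in I$, there is a set $F\in\mathcal{F}$ with $F\subset\{n\in\mathbb{N}:x^{(i)}_n\in V_i\}$ for every $i\in I$. Here $I=[J]$ and $X_j=\mathbb{R}^4$. *)

(* Defs.v *)
From HB Require Import structures.
From mathcomp Require Import all_boot all_order all_algebra.
From mathcomp Require Import finmap boolp classical_sets functions filter reals topology normedtype.
From mathcomp Require Import complex sesquilinear summability lra ring zify.

Set Implicit Arguments.
Unset Strict Implicit.
Unset Printing Implicit Defensive.
Import Order.TTheory GRing.Theory Num.Theory.
Import numFieldNormedType.Exports.
Local Open Scope classical_set_scope.
Local Open Scope ring_scope.
Local Open Scope complex_scope.

Section RealNorm.
Context {R : realType}.

(* The library norm of a normed module over R[i] takes values in R[i]; rnorm is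
   the same number as an element of R. *)
Definition rnorm {V : normedModType R[i]} (x : V) : R := complex.Re `|x|.

Definition cmod (a : R[i]) : R := complex.Re `|a|.

Lemma cmodE (a : R[i]) : `|a| = (cmod a)%:C.
Proof. by rewrite /cmod RRe_real// normr_real. Qed.

Lemma cmod_ge0 (a : R[i]) : 0 <= cmod a.
Proof. by rewrite -ler0c -cmodE. Qed.

Lemma cmodM (a b : R[i]) : cmod (a * b) = cmod a * cmod b.
Proof. by apply: complexI; rewrite rmorphM /= -!cmodE normrM. Qed.

Lemma cmodD (a b : R[i]) : cmod (a + b) <= cmod a + cmod b.
Proof. by rewrite -lecR rmorphD /= -!cmodE ler_normD. Qed.

Lemma cmod_conj (a : R[i]) : cmod (Num.conj a) = cmod a.
Proof. by apply: complexI; rewrite -!cmodE norm_conjC. Qed.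

Lemma cmod_real (r : R) : cmod r%:C = `|r|.
Proof. by rewrite /cmod normc_def /= expr0n addr0 sqrtr_sqr. Qed.

Lemma Re_le_cmod (a : R[i]) : `|complex.Re a| <= cmod a.
Proof. by rewrite -lecR -cmodE normc_ge_Re. Qed.

Lemma cmod_eq0 (a : R[i]) : cmod a = 0 -> a = 0.
Proof. by move=> h; apply/eqP; rewrite -normr_eq0 cmodE h. Qed.

Variable V : normedModType R[i].
Implicit Types (x y : V) (F : set_system V).

Lemma rnormE x : `|x| = (rnorm x)%:C.
Proof. by rewrite /rnorm RRe_real// normr_real. Qed.

Lemma rnorm_ge0 x : 0 <= rnorm x.
Proof. by rewrite -ler0c -rnormE. Qed.

Lemma rnormD x y : rnorm (x + y) <= rnorm x + rnorm y.
Proof. by rewrite -lecR rmorphD /= -!rnormE ler_normD. Qed.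

Lemma rnormN x : rnorm (- x) = rnorm x.
Proof. by rewrite /rnorm normrN. Qed.

Lemma rnormBC x y : rnorm (x - y) = rnorm (y - x).
Proof. by rewrite -rnormN opprB. Qed.

Lemma rnormZ (a : R[i]) x : rnorm (a *: x) = cmod a * rnorm x.
Proof. by apply: complexI; rewrite rmorphM /= -!rnormE -cmodE normrZ. Qed.

Lemma rnorm0 : rnorm (0 : V) = 0.
Proof. by rewrite /rnorm normr0. Qed.

Lemma rnorm0_eq0 x : rnorm x = 0 -> x = 0.
Proof. by move=> h; apply/eqP; rewrite -normr_eq0 rnormE h. Qed.

Lemma rnormB x y : rnorm (x - y) <= rnorm x + rnorm y.
Proof. by rewrite (le_trans (rnormD _ _))// rnormN. Qed.

Lemma rnorm_tri x y z : rnorm (x - z) <= rnorm (x - y) + rnorm (y - z).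
Proof. by rewrite (_ : x - z = (x - y) + (y - z)) ?rnormD// addrA subrK. Qed.

Lemma gt0_complex (e : R[i]) : 0 < e -> exists2 r : R, 0 < r & e = r%:C.
Proof.
move=> e0; exists (complex.Re e); last by rewrite RRe_real// gtr0_real.
by rewrite -(ltcR 0) RRe_real ?gtr0_real.
Qed.

Lemma cvg_rnormP {T} (F : set_system T) (FF : Filter F) (f : T -> V) x :
  f @ F --> x <-> forall e : R, 0 < e -> \forall t \near F, rnorm (x - f t) < e.
Proof.
split.
  move=> /cvgrPdist_lt cf e e0.
  have /cf : 0 < e%:C by rewrite ltcR.
  by apply: filterS => t; rewrite rnormE ltcR.
move=> h; apply/cvgrPdist_lt => _ /gt0_complex[e e0 ->].
by move/h: e0; apply: filterS => t; rewrite rnormE ltcR.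
Qed.

Lemma cauchy_rnormP F (FF : ProperFilter F) :
  (forall e : R, 0 < e -> exists x, F [set y | rnorm (x - y) < e]) <-> cauchy F.
Proof.
split.
  move=> h; apply/cauchy_exP => _ /gt0_complex[e e0 ->].
  have [x Fx] := h e e0; exists x; apply: filterS Fx => y /=.
  by rewrite -ball_normE /ball_ /= rnormE ltcR.
move=> /cauchyP h e e0; have /h[x Fx] : 0 < e%:C by rewrite ltcR.
exists x; apply: filterS Fx => y /=.
by rewrite -ball_normE /ball_ /= rnormE ltcR.
Qed.

End RealNorm.

(* A complex Hilbert space; ip is linear in its first argument. *)
HB.mixin Record isHilbert (R : realType) H of CompleteNormedModule R[i] H := {
  ip : {dot H for @Num.conj R[i]};
  ipxx : forall x : H, ip x x = `|x| ^+ 2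
}.

#[short(type="hilbertType")]
HB.structure Definition Hilbert (R : realType) :=
  {H of isHilbert R H & CompleteNormedModule R[i] H}.

Arguments ip {R s} : rename.

Section Hilbert.
Context {R : realType} {H : hilbertType R}.
Implicit Types (x y z : H) (a : R[i]).
Local Notation Re := (@complex.Re _).

Lemma ipDl x y z : ip (x + y) z = ip x z + ip y z.
Proof. exact: linearDl. Qed.
Lemma ipDr x y z : ip x (y + z) = ip x y + ip x z.
Proof. exact: linearDr. Qed.
Lemma ipBl x y z : ip (x - y) z = ip x z - ip y z.
Proof. exact: linearBl. Qed.
Lemma ipBr x y z : ip x (y - z) = ip x y - ip x z.
Proof. exact: linearBr. Qed.
Lemma ipNl x y : ip (- x) y = - ip x y.
Proof. exact: linearNl. Qed.
Lemma ipNr x y : ip x (- y) = - ip x y.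
Proof. exact: linearNr. Qed.
Lemma ip0l x : ip 0 x = 0.
Proof. exact: linear0l. Qed.
Lemma ip0r x : ip x 0 = 0.
Proof. exact: linear0r. Qed.
Lemma ipZl a x y : ip (a *: x) y = a * ip x y.
Proof. exact: linearZl_LR. Qed.
Lemma ipZr a x y : ip x (a *: y) = Num.conj a * ip x y.
Proof. exact: linearZr_LR. Qed.
Lemma ip_suml (I : Type) (r : seq I) (P : pred I) (E : I -> H) y :
  ip (\sum_(i <- r | P i) E i) y = \sum_(i <- r | P i) ip (E i) y.
Proof. exact: linear_sumlz. Qed.
Lemma ip_sumr (I : Type) (r : seq I) (P : pred I) (E : I -> H) y :
  ip y (\sum_(i <- r | P i) E i) = \sum_(i <- r | P i) ip y (E i).
Proof. exact: linear_sumr. Qed.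
Lemma ipC x y : ip y x = Num.conj (ip x y).
Proof. by rewrite (hermC ip) /= mul1r. Qed.

Lemma ReipC x y : Re (ip y x) = Re (ip x y).
Proof. by rewrite ipC; case: (ip x y). Qed.

Lemma ipxxR x : ip x x = (rnorm x ^+ 2)%:C.
Proof. by rewrite ipxx rnormE rmorphXn. Qed.

Lemma Re_ipxx x : Re (ip x x) = rnorm x ^+ 2.
Proof. by rewrite ipxxR. Qed.

Lemma rnormD2 x y :
  rnorm (x + y) ^+ 2 = rnorm x ^+ 2 + rnorm y ^+ 2 + 2 * Re (ip x y).
Proof.
rewrite -!Re_ipxx ipDl !ipDr !raddfD /= (ReipC x y); lra.
Qed.

Lemma ReZr (r : R) a : Re (r%:C * a) = r * Re a.
Proof. by case: a => u v /=; rewrite mul0r subr0. Qed.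

Lemma conjR (r : R) : Num.conj r%:C = r%:C.
Proof. by rewrite conj_Creal// complex_real. Qed.

(* a phase rotating a complex number to its modulus *)
Lemma phase a : exists2 b : R[i], cmod b = 1 & b * a = (cmod a)%:C.
Proof.
have [->|a0] := eqVneq a 0.
  by exists 1; rewrite ?mulr0 /cmod ?normr1 ?normr0.
exists (`|a| / a); last by rewrite divfK// cmodE.
by apply: complexI; rewrite -cmodE normrM normrV ?unitfE// normr_id divff// normr_eq0.
Qed.

Lemma CauchySchwarz_ip x y : cmod (ip x y) <= rnorm x * rnorm y.
Proof.
have [b b1 bE] := phase (ip x y).
suff : Re (ip (b *: x) y) <= rnorm (b *: x) * rnorm y.
  by rewrite ipZl bE rnormZ b1 mul1r.
move: (b *: x) => {b b1 bE} u.

have [/rnorm0_eq0 ->|y0] := eqVneq (rnorm y) 0; first by rewrite ip0r rnorm0 mulr0.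
have M0 : 0 < rnorm y ^+ 2 by rewrite exprn_gt0// lt_neqAle eq_sym y0 rnorm_ge0.
set c := Re (ip u y).
have := sqr_ge0 (rnorm (u + (- (c / rnorm y ^+ 2))%:C *: y)).
rewrite rnormD2 rnormZ exprMn cmod_real real_normK ?num_real//.
rewrite ipZr conjR ReZr -/c => h.
have {}h : c ^+ 2 <= (rnorm u * rnorm y) ^+ 2.
  rewrite exprMn -ler_pdivrMr// -subr_ge0; apply: le_trans h _.
  by rewrite le_eqVlt; apply/orP; left; apply/eqP; field.
rewrite (le_trans (ler_norm _))// -ler_sqr ?nnegrE ?mulr_ge0 ?rnorm_ge0//.
by rewrite real_normK ?num_real.
Qed.

Lemma quad0 (c n : R) : 0 <= n -> (forall t, 0 <= 2 * t * c + t ^+ 2 * n) -> c = 0.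
Proof.
move=> n0 /(_ (- c / (n + 1))) h.
have k0 : 0 < n + 1 by lra.
have {}h : 0 <= - (c ^+ 2 * (n + 2)) / (n + 1) ^+ 2.
  by rewrite (le_trans h)// le_eqVlt; apply/orP; left; apply/eqP; field; rewrite gt_eqF.
have {}h : c ^+ 2 * (n + 2) <= 0.
  by move: h; rewrite pmulr_lge0 ?oppr_ge0// invr_gt0 exprn_gt0.
have n2 : 0 < n + 2 by lra.
by rewrite (pmulr_lle0 _ n2) in h; apply/eqP; rewrite -sqrf_eq0 eq_le h sqr_ge0.
Qed.

Lemma riesz (f : H -> R[i]) (M : R) :
  (forall a x y, f (a *: x + y) = a * f x + f y) ->
  (forall x, cmod (f x) <= M * rnorm x) -> exists u, forall x, f x = ip x u.
Proof.
move=> fL fM.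
have f0 : f 0 = 0.
  by have := fL (-1) 0 0; rewrite scaler0 addr0 mulN1r addNr.
have fD x y : f (x + y) = f x + f y by have := fL 1 x y; rewrite scale1r mul1r.
have fZ a x : f (a *: x) = a * f x by have := fL a x 0; rewrite !addr0 f0 addr0.
pose Q x := rnorm x ^+ 2 - 2 * Re (f x).
have Qlb : lbound (range Q) (- M ^+ 2).
  move=> _ [x _ <-]; rewrite /Q.
  have h1 : Re (f x) <= M * rnorm x.
    exact: le_trans (ler_norm _) (le_trans (Re_le_cmod _) (fM x)).
  have := sqr_ge0 (rnorm x - M); rewrite sqrrB; lra.
have Qinf : has_inf (range Q).
  by split; [exists (Q 0), 0|exists (- M ^+ 2)].
pose m := inf (range Q).
have Qm x : m <= Q x by apply: ge_inf; [case: Qinf|exists x].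
pose F : set_system H := filter_from [set e : R | 0 < e] (fun e => [set x | Q x < m + e]).
have FF : ProperFilter F.
  apply: filter_from_proper.
    apply: filter_from_filter; first by exists 1 => /=.
    move=> e1 e2 /= e10 e20; exists (Num.min e1 e2); first by rewrite /= lt_min e10.
    by move=> z /= hx; split; apply: lt_le_trans hx _; rewrite lerD2l ge_min lexx ?orbT.
  move=> e e0; have [_ [x _ <-] hx] := inf_adherent e0 Qinf.
  by exists x.
have par x y : rnorm (x - y) ^+ 2 = 2 * Q x + 2 * Q y - 4 * Q (2^-1%:C *: (x + y)).
  rewrite /Q rnormZ exprMn cmod_real fZ ReZr fD !rnormD2 rnormN ipNr !raddfD /= raddfN /=.
  by rewrite real_normK ?num_real//; field.
have Fc : cauchy F.
  apply/cauchy_rnormP => e e0.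
  have d0 : 0 < e ^+ 2 / 4 by rewrite divr_gt0 ?exprn_gt0.
  have [_ [x1 _ <-] hx] := inf_adherent d0 Qinf.
  exists x1; exists (e ^+ 2 / 4) => [|y1 /= hy]; first by [].
  rewrite -ltr_sqr ?nnegrE ?rnorm_ge0 ?ltW// par.
  have := Qm (2^-1%:C *: (x1 + y1)); rewrite -/m in hx; lra.
have Fu : F --> lim F by exact: cauchy_cvg.
set u := lim F in Fu.
have key v : Re (ip v u) = Re (f v).
  apply/eqP; rewrite -subr_eq0; apply/eqP.
  apply: (@quad0 _ (rnorm v ^+ 2)); first exact: sqr_ge0.
  move=> t; apply/ler_addgt0Pr => e e0.
  pose d := e / 2 / (2 * `|t| * rnorm v + 1).
  have k0 : 0 < 2 * `|t| * rnorm v + 1.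
    by rewrite ltr_wpDl// !mulr_ge0// ?rnorm_ge0.
  have d0 : 0 < d by rewrite !divr_gt0.
  have /cvg_rnormP/(_ d d0) h1 : id @ F --> u by exact: Fu.
  have h2 : F [set x | Q x < m + e / 2] by exists (e / 2) => //=; rewrite divr_gt0.
  have [y [/= /ltW yu yQ]] := filter_ex (filterI h1 h2).
  have := Qm (y + t%:C *: v).
  rewrite {1}/Q rnormD2 rnormZ exprMn cmod_real real_normK ?num_real//.
  rewrite ipZr conjR ReZr fD fZ raddfD /= ReZr (ReipC v y) => h3.
  have h4 : t * (Re (ip v y) - Re (ip v u)) <= `|t| * (rnorm v * rnorm (u - y)).
    rewrite (le_trans (ler_norm _))// normrM ler_wpM2l//.
    rewrite -raddfB -ipBr (le_trans (Re_le_cmod _))// rnormBC.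
    exact: CauchySchwarz_ip.
  have h5 : 2 * `|t| * rnorm v * rnorm (u - y) <= e / 2.
    apply: (@le_trans _ _ ((2 * `|t| * rnorm v + 1) * d)).
      rewrite ler_pM ?mulr_ge0 ?rnorm_ge0//; lra.
    by rewrite /d mulrC divfK// gt_eqF.
  rewrite /Q in yQ; lra.
exists u => x; apply/eqP; rewrite eq_complex key eqxx /=.
have := key ('i *: x); rewrite ipZl fZ.
by case: (ip x u) (f x) => [a b] [c d] /=; rewrite !mul0r !mul1r !sub0r => /oppr_inj->.
Qed.

End Hilbert.

Section BoundedOperators.
Context {R : realType} {H : hilbertType R}.

Definition bounded_op : {pred H -> H} := [pred T : H -> H |
  `[< linear T /\ exists M : R, forall x, rnorm (T x) <= M * rnorm x >]].

Record bop := Bop { bop_fun :> H -> H; _ : bop_fun \in bounded_op }.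

HB.instance Definition _ := [isSub for bop_fun].
HB.instance Definition _ := [Choice of bop by <:].

Lemma bounded_opP (T : H -> H) : reflect
  (linear T /\ exists M : R, forall x, rnorm (T x) <= M * rnorm x)
  (T \in bounded_op).
Proof. exact: asboolP. Qed.

Fact bounded_op_submod : submod_closed bounded_op.
Proof.
split; first by apply/bounded_opP; split => [a x y|]; [rewrite /= scaler0 addr0|
  exists 0 => x; rewrite mul0r rnorm0].
move=> a S T /bounded_opP[Sl [M SM]] /bounded_opP[Tl [N TN]].
apply/bounded_opP; split.
  move=> b x y; rewrite /= !fctE Sl Tl !scalerDr !scalerA [a * b]mulrC.
  by rewrite addrACA.
exists (cmod a * M + N) => x; rewrite !fctE.
rewrite (le_trans (rnormD _ _))// rnormZ mulrDl lerD// -mulrA.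
by rewrite ler_wpM2l ?cmod_ge0.
Qed.

HB.instance Definition _ := GRing.isSubmodClosed.Build R[i] (H -> H) bounded_op
  bounded_op_submod.
HB.instance Definition _ := [SubChoice_isSubLmodule of bop by <:].

Implicit Types (S T : bop) (x y : H).

Lemma bopP S T : S =1 T -> S = T.
Proof. by move=> ST; apply/val_inj/funext. Qed.

Lemma bop_linear T : linear T.
Proof. by have /bounded_opP[] := valP T. Qed.

Lemma bop_bounded T : exists M : R, forall x, rnorm (T x) <= M * rnorm x.
Proof. by have /bounded_opP[] := valP T. Qed.

Lemma bopD T x y : T (x + y) = T x + T y.
Proof. by have := bop_linear T 1 x y; rewrite !scale1r. Qed.

Lemma bop0 T : T 0 = 0.
Proof. by have := bop_linear T (-1) 0 0; rewrite scaler0 addr0 scaleN1r addNr. Qed.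

Lemma bopZ T a x : T (a *: x) = a *: T x.
Proof. by have := bop_linear T a x 0; rewrite !addr0 bop0 addr0. Qed.

Lemma bopB T x y : T (x - y) = T x - T y.
Proof. by rewrite -scaleN1r bopD bopZ scaleN1r. Qed.

Lemma addbE S T x : (S + T) x = S x + T x.
Proof. by []. Qed.
Lemma oppbE S x : (- S) x = - S x.
Proof. by []. Qed.
Lemma zerobE x : (0 : bop) x = 0.
Proof. by []. Qed.
Lemma scalebE a S x : (a *: S) x = a *: S x.
Proof. by []. Qed.
Lemma sumbE I (r : seq I) (P : pred I) (E : I -> bop) x :
  (\sum_(i <- r | P i) E i) x = \sum_(i <- r | P i) E i x.
Proof.
apply: (big_ind2 (fun (S : bop) y => S x = y)) => //.
by move=> S y S' y' <- <-.
Qed.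

Fact idb_subproof : id \in bounded_op.
Proof. by apply/bounded_opP; split => //; exists 1 => x; rewrite mul1r. Qed.

Fact compb_subproof S T : S \o T \in bounded_op.
Proof.
apply/bounded_opP; split; first by move=> a x y; rewrite /= !bop_linear.
have [M SM] := bop_bounded S; have [N TN] := bop_bounded T.
exists (`|M| * N) => x /=; rewrite (le_trans (SM _))//.
rewrite (le_trans (ler_wpM2r (rnorm_ge0 _) (ler_norm M)))//.
by rewrite -mulrA ler_wpM2l.
Qed.

Definition idb : bop := Bop idb_subproof.
Definition compb S T : bop := Bop (compb_subproof S T).

Fact compbA : associative compb.
Proof. by move=> ? ? ?; apply: bopP. Qed.
Fact comp1b : left_id idb compb.
Proof. by move=> ?; apply: bopP. Qed.
Fact compb1 : right_id idb compb.
Proof. by move=> ?; apply: bopP. Qed.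
Fact compbDl : left_distributive compb +%R.
Proof. by move=> ? ? ?; apply: bopP. Qed.
Fact compbDr : right_distributive compb +%R.
Proof. by move=> ? ? ?; apply: bopP => x; rewrite /= bopD. Qed.

HB.instance Definition _ := GRing.Zmodule_isPzRing.Build bop
  compbA comp1b compb1 compbDl compbDr.

Lemma mulbE S T x : (S * T) x = S (T x).
Proof. by []. Qed.
Lemma onebE x : (1 : bop) x = x.
Proof. by []. Qed.

Definition opnorm T : R := sup [set rnorm (T x) | x in [set x | rnorm x <= 1]].

Fact opnorm_has_sup T : has_sup [set rnorm (T x) | x in [set x | rnorm x <= 1]].
Proof.
split; first by exists (rnorm (T 0)), 0 => //=; rewrite rnorm0.
have [M TM] := bop_bounded T; exists `|M| => _ [x /= x1 <-].
rewrite (le_trans (TM x))// (le_trans (ler_wpM2r (rnorm_ge0 _) (ler_norm M)))//.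
by rewrite -[leRHS]mulr1 ler_wpM2l.
Qed.

Lemma opnorm_ge0 T : 0 <= opnorm T.
Proof.
apply: le_trans (rnorm_ge0 (T 0)) _; apply: ub_le_sup; first by case: (opnorm_has_sup T).
by exists 0 => //=; rewrite rnorm0.
Qed.

Lemma opnorm_le T (M : R) : 0 <= M ->
  (forall x, rnorm (T x) <= M * rnorm x) -> opnorm T <= M.
Proof.
move=> M0 TM; apply: ge_sup; first by case: (opnorm_has_sup T).
move=> _ [x /= x1 <-]; rewrite (le_trans (TM x))//.
by rewrite -[leRHS]mulr1 ler_wpM2l.
Qed.

Lemma le_opnorm T x : rnorm (T x) <= opnorm T * rnorm x.
Proof.
have [/rnorm0_eq0->|x0] := eqVneq (rnorm x) 0.
  by rewrite bop0 rnorm0 mulr0.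
have {}x0 : 0 < rnorm x by rewrite lt_neqAle eq_sym x0 rnorm_ge0.
rewrite -ler_pdivrMr//.
have -> : rnorm (T x) / rnorm x = rnorm (T ((rnorm x)^-1%:C *: x)).
  by rewrite bopZ rnormZ cmod_real ger0_norm 1?mulrC// invr_ge0 ltW.
apply: ub_le_sup; first by case: (opnorm_has_sup T).
exists ((rnorm x)^-1%:C *: x) => //=.
rewrite rnormZ cmod_real ger0_norm; last by rewrite invr_ge0 ltW.
by rewrite mulVf// lt0r_neq0.
Qed.

Fact opnorm_triangle S T : (opnorm (S + T))%:C <= (opnorm S)%:C + (opnorm T)%:C.
Proof.
rewrite -rmorphD lecR; apply: opnorm_le; first by rewrite addr_ge0 ?opnorm_ge0.
move=> x; rewrite addbE (le_trans (rnormD _ _))// mulrDl lerD// ?le_opnorm//.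
Qed.

Fact opnormZ (a : R[i]) T : (opnorm (a *: T))%:C = `|a| * (opnorm T)%:C.
Proof.
rewrite cmodE -rmorphM; congr (_ %:C).
have h b S : opnorm (b *: S) <= cmod b * opnorm S.
  apply: opnorm_le; first by rewrite mulr_ge0 ?opnorm_ge0 ?cmod_ge0.
  by move=> x; rewrite scalebE rnormZ -mulrA ler_wpM2l ?cmod_ge0// le_opnorm.
apply/eqP; rewrite eq_le h /=.
have [->|a0] := eqVneq a 0; first by rewrite cmod_real normr0 mul0r opnorm_ge0.
have ca : 0 < cmod a by rewrite -ltcR -cmodE normr_gt0.
rewrite mulrC -ler_pdivlMr// mulrC.
have -> : (cmod a)^-1 = cmod a^-1.
  apply: (mulfI (lt0r_neq0 ca)); rewrite -(cmodM a a^-1) divff; last exact: lt0r_neq0.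
  by rewrite divff// cmod_real normr1.
by apply: le_trans _ (h _ _); rewrite scalerA mulVf// scale1r.
Qed.

Fact opnorm0_eq0 T : (opnorm T)%:C = 0 -> T = 0.
Proof.
move=> /complexI T0; apply: bopP => x; apply: rnorm0_eq0.
by apply/eqP; rewrite eq_le rnorm_ge0 andbT (le_trans (le_opnorm T x))// T0 mul0r.
Qed.

HB.instance Definition _ := Lmodule_isNormed.Build R[i] bop
  opnorm_triangle opnormZ opnorm0_eq0.

Lemma rnorm_opnorm T : rnorm T = opnorm T.
Proof. by []. Qed.

Lemma bop_le T x : rnorm (T x) <= rnorm T * rnorm x.
Proof. exact: le_opnorm. Qed.

Lemma rnorm_bop_le T (M : R) : 0 <= M ->
  (forall x, rnorm (T x) <= M * rnorm x) -> rnorm T <= M.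
Proof. exact: opnorm_le. Qed.

Lemma rnormM S T : rnorm (S * T) <= rnorm S * rnorm T.
Proof.
apply: rnorm_bop_le; first by rewrite mulr_ge0 ?rnorm_ge0.
move=> x; rewrite mulbE (le_trans (bop_le _ _))// -mulrA.
by rewrite ler_wpM2l ?rnorm_ge0// bop_le.
Qed.

Lemma scalerbAl a S T : a *: (S * T) = (a *: S) * T.
Proof. by apply: bopP. Qed.

Lemma scalerbAr a S T : a *: (S * T) = S * (a *: T).
Proof. by apply: bopP => x; rewrite scalebE !mulbE scalebE bopZ. Qed.

Fact bop_complete (F : set_system bop) : ProperFilter F -> cauchy F -> cvg F.
Proof.
move=> FF /cauchy_rnormP Fc.
have cx x : cauchy ((fun T : bop => T x) @ F).
  apply/cauchy_rnormP => e e0.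
  have d0 : 0 < e / (rnorm x + 1) by rewrite divr_gt0// ltr_wpDl// rnorm_ge0.
  have [T FT] := Fc _ d0; exists (T x).
  change (F [set S : bop | rnorm (T x - S x) < e]).
  apply: filterS FT => S /= TS.
  have := bop_le (T - S) x; rewrite addbE oppbE => /le_lt_trans; apply.
  apply: (@le_lt_trans _ _ (rnorm (T - S) * (rnorm x + 1))).
    by rewrite ler_wpM2l ?rnorm_ge0// lerDl.
  by rewrite -ltr_pdivlMr// ltr_wpDl// rnorm_ge0.
pose g x := lim ((fun T : bop => T x) @ F).
have gP x (e : R) : 0 < e -> \forall T \near F, rnorm (g x - (T : bop) x) < e.
  have : (fun T : bop => T x) @ F --> g x by exact: cauchy_cvg.
  by move=> /cvg_rnormP; apply.
have gl : linear g.
  move=> a x y; apply/eqP; rewrite -subr_eq0 -normr_eq0 rnormE; apply/eqP.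
  congr (_ %:C); apply/eqP; rewrite eq_le rnorm_ge0 andbT.
  apply/ler_addgt0Pr => e e0; rewrite add0r.
  have e3 : 0 < e / 3 by rewrite divr_gt0.
  have k0 : 0 < cmod a + 1 by rewrite ltr_wpDl// cmod_ge0.
  have d0 : 0 < e / 3 / (cmod a + 1) by rewrite divr_gt0.
  have [T [[h1 h2] h3]] := filter_ex
    (filterI (filterI (gP x _ d0) (gP y _ e3)) (gP (a *: x + y) _ e3)).
  have -> : g (a *: x + y) - (a *: g x + g y) = (g (a *: x + y) - T (a *: x + y))
     - (a *: (g x - T x) + (g y - T y)).
    rewrite bop_linear; move: (g _) (g x) (g y) (T x) (T y) => u v w s t.
    rewrite !scalerBr (addrACA (a *: v)) -opprD opprB.
    by rewrite addrA subrK.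
  rewrite (le_trans (rnormB _ _))//.
  have h4 : rnorm (a *: (g x - T x) + (g y - T y)) <= e / 3 + e / 3.
    rewrite (le_trans (rnormD _ _))// lerD//; last exact: ltW.
    rewrite rnormZ.
    apply: (@le_trans _ _ ((cmod a + 1) * (e / 3 / (cmod a + 1)))).
      by rewrite ler_pM ?cmod_ge0 ?rnorm_ge0 ?lerDl// ltW.
    by rewrite mulrC divfK// gt_eqF.
  have := h3; lra.
have unif (e : R) : 0 < e -> exists2 A : set bop, F A &
    forall T, A T -> forall x, rnorm (g x - T x) <= e * rnorm x.
  move=> e0; have e2 : 0 < e / 2 by rewrite divr_gt0.
  have [T0 FT0] := Fc _ e2; exists [set T | rnorm (T0 - T) < e / 2] => //.
  move=> T /= hT x; apply/ler_addgt0Pr => d d0.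
  have [S [/= hS gS]] := filter_ex (filterI FT0 (gP x _ d0)).
  rewrite (le_trans (rnorm_tri _ (S x) _))// [leRHS]addrC lerD//; first exact: ltW.
  apply: (le_trans (bop_le (S - T) x)); rewrite ler_wpM2r ?rnorm_ge0//.
  rewrite (le_trans (rnorm_tri _ T0 _))// (splitr e) lerD//; last exact: ltW.
  by rewrite rnormBC ltW.
have gb : g \in bounded_op.
  apply/bounded_opP; split=> //.
  have [A /filter_ex[T AT] hA] := unif 1 ltr01.
  exists (1 + rnorm T) => x; rewrite -[X in rnorm X](subrK (T x)).
  rewrite (le_trans (rnormD _ _))// mulrDl lerD ?bop_le//.
  exact: hA.
apply/cvg_ex; exists (Bop gb).
suff : id @ F --> Bop gb by [].
apply/cvg_rnormP => e e0; have e2 : 0 < e / 2 by rewrite divr_gt0.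
have [A FA hA] := unif _ e2; near=> T.
apply: (@le_lt_trans _ _ (e / 2)); last by rewrite ltr_pdivrMr// mulr_natr mulr2n ltrDr.
apply: rnorm_bop_le; first exact: ltW.
by move=> x; rewrite addbE oppbE /=; apply: hA; near: T.
Unshelve. all: by end_near. Qed.

HB.instance Definition _ := Uniform_isComplete.Build bop bop_complete.

End BoundedOperators.
Arguments bop {R} H.
Arguments bounded_op {R} H.

Section Adjoint.
Context {R : realType} {H : hilbertType R}.
Implicit Types (S T : bop H) (x y : H).

(* The default value 0 is never used, see adjointE. *)
Definition adjoint T : bop H :=
  xget 0 [set S : bop H | forall x y, ip (T x) y = ip x (S y)].

Lemma ip_ext x y : (forall z, ip z x = ip z y) -> x = y.
Proof.
move=> h; apply/eqP; rewrite -subr_eq0 -normr_eq0 -sqrf_eq0 -ipxx.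
by rewrite ipBr h subrr.
Qed.

Lemma adjointE T x y : ip (T x) y = ip x (adjoint T y).
Proof.
rewrite /adjoint; case: xgetP => [S _ /(_ x y)//|noS]; exfalso.
have /choice[g gP] : forall y, exists u, forall x, ip (T x) y = ip x u.
  move=> {}y; apply: (@riesz _ _ (fun x => ip (T x) y) (rnorm T * rnorm y)).
    by move=> a u v; rewrite bop_linear ipDl ipZl.
  move=> u; rewrite (le_trans (CauchySchwarz_ip _ _))// mulrAC.
  by rewrite ler_wpM2r ?rnorm_ge0// bop_le.
have gb : g \in bounded_op H.
  apply/bounded_opP; split.
    by move=> a u v; apply: ip_ext => z; rewrite -gP !(ipDr, ipZr) -!gP.
  exists (rnorm T) => u.
  have [->|g0] := eqVneq (rnorm (g u)) 0; first by rewrite mulr_ge0 ?rnorm_ge0.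
  have {}g0 : 0 < rnorm (g u) by rewrite lt_neqAle eq_sym g0 rnorm_ge0.
  rewrite -(ler_pM2r g0) -expr2 -Re_ipxx -gP.
  rewrite (le_trans (ler_norm _))// (le_trans (Re_le_cmod _))//.
  rewrite (le_trans (CauchySchwarz_ip _ _))// mulrAC.
  by rewrite ler_wpM2r ?rnorm_ge0// bop_le.
by apply: (noS (Bop gb)) => u v; exact: gP.
Qed.

Lemma adjoint_uniq T S : (forall x y, ip (T x) y = ip x (S y)) -> S = adjoint T.
Proof. by move=> h; apply: bopP => y; apply: ip_ext => x; rewrite -h adjointE. Qed.

Lemma adjointEr T x y : ip x (T y) = ip (adjoint T x) y.
Proof. by rewrite ipC adjointE -ipC. Qed.

Lemma adjointK : involutive adjoint.
Proof. by move=> T; apply/esym/adjoint_uniq => x y; rewrite adjointEr. Qed.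

Lemma adjointD S T : adjoint (S + T) = adjoint S + adjoint T.
Proof.
apply/esym/adjoint_uniq => x y.
by rewrite !addbE ipDl ipDr !adjointE.
Qed.

Lemma adjointZ a T : adjoint (a *: T) = Num.conj a *: adjoint T.
Proof.
apply/esym/adjoint_uniq => x y.
by rewrite !scalebE ipZl ipZr conjCK adjointE.
Qed.

Lemma adjointM S T : adjoint (S * T) = adjoint T * adjoint S.
Proof. by apply/esym/adjoint_uniq => x y; rewrite !mulbE !adjointE. Qed.

Definition unitary_op T := adjoint T * T = 1 /\ T * adjoint T = 1.

Definition compact_op T := precompact (T @` [set x : H | `|x| <= 1]).

Lemma bop_continuous T : continuous T.
Proof.
move=> x; apply/cvg_rnormP => e e0.
have d0 : 0 < e / (rnorm T + 1) by rewrite divr_gt0// ltr_wpDl// rnorm_ge0.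
have /cvg_rnormP/(_ _ d0) : id @ x --> x by exact: cvg_id.
apply: filterS => y /= xy; rewrite -bopB (le_lt_trans (bop_le _ _))//.
apply: (@le_lt_trans _ _ ((rnorm T + 1) * rnorm (x - y))).
  by rewrite ler_wpM2r ?rnorm_ge0// lerDl.
by rewrite mulrC -ltr_pdivlMr// ltr_wpDl// rnorm_ge0.
Qed.

Lemma precompact_image (T U : normedModType R[i]) (f : T -> U) (A : set T) :
  continuous f -> precompact A -> precompact (f @` A).
Proof.
move=> cf; rewrite precompactE => cA.
apply: (@precompact_subset _ _ (f @` closure A)).
  by apply: image_subset; exact: subset_closure.
apply: compact_precompact; first exact: norm_hausdorff.
by apply: continuous_compact => //; exact: continuous_subspaceT.
Qed.

Lemma compact_op_ball T (M : R) : compact_op T ->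
  precompact (T @` [set x | rnorm x <= M]).
Proof.
move=> cT; have k0 : 0 < `|M| + 1 by rewrite ltr_wpDl.
apply: (@precompact_subset _ _
    (( *:%R (`|M| + 1)%:C) @` (T @` [set x : H | `|x| <= 1]))); last first.
  by apply: precompact_image => //; exact: scaler_continuous.
move=> _ [x /= xM <-]; exists (T ((`|M| + 1)^-1%:C *: x)).
  exists ((`|M| + 1)^-1%:C *: x) => //=.
  rewrite rnormE lecR rnormZ cmod_real ger0_norm ?invr_ge0 ?(ltW k0)//.
  rewrite ler_pdivrMl// mulr1 (le_trans xM)// (le_trans (ler_norm M))//.
  by rewrite lerDl.
by rewrite bopZ scalerA -rmorphM mulfV ?lt0r_neq0// scale1r.
Qed.

Lemma compact_op0 : compact_op 0.
Proof.
apply: (@precompact_subset _ _ [set 0]); first by move=> _ [x _ <-].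
apply: compact_precompact; first exact: norm_hausdorff.
exact: compact_set1.
Qed.

Lemma compact_opD S T : compact_op S -> compact_op T -> compact_op (S + T).
Proof.
rewrite {1 2}/compact_op !precompactE => cS cT.
have := compact_setX cS cT; set K := _ `*` _ => cK.
apply: (@precompact_subset _ _ ((fun z : H * H => z.1 + z.2) @` K)).
  move=> _ [x /= x1 <-]; exists (S x, T x) => //.
  by split => /=; apply: subset_closure; exists x.
apply: compact_precompact; first exact: norm_hausdorff.
by apply: continuous_compact => //; apply: continuous_subspaceT; exact: add_continuous.
Qed.

Lemma compact_opMl S T : compact_op T -> compact_op (S * T).
Proof.
move=> cT; rewrite /compact_op.
rewrite (_ : (S * T) @` _ = S @` (T @` [set x : H | `|x| <= 1])).
  by apply: precompact_image => //; exact: bop_continuous.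
by rewrite -image_comp.
Qed.

Lemma compact_opMr S T : compact_op T -> compact_op (T * S).
Proof.
move=> /(@compact_op_ball _ (rnorm S)); apply: precompact_subset.
move=> _ [x /= x1 <-]; exists (S x) => //=.
rewrite rnormE (lecR _ 1) in x1.
by rewrite (le_trans (bop_le _ _))// -[leRHS]mulr1 ler_wpM2l ?rnorm_ge0.
Qed.

Lemma compact_opZ a T : compact_op T -> compact_op (a *: T).
Proof. by move=> cT; rewrite -[T]mul1r scalerbAl; apply: compact_opMl. Qed.

Lemma compact_op_sum I (r : seq I) (P : pred I) (E : I -> bop H) :
  (forall i, P i -> compact_op (E i)) -> compact_op (\sum_(i <- r | P i) E i).
Proof.
by move=> h; apply: (big_ind compact_op) => //; [exact: compact_op0|exact: compact_opD].
Qed.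

Lemma compact_op_closed T :
  (forall e : R, 0 < e -> exists2 S, compact_op S & rnorm (T - S) < e) ->
  compact_op T.
Proof.
move=> h; rewrite /compact_op precompactE compact_ultra => F UF FT.
have FF : ProperFilter F by exact: ultra_proper.
set B := [set x : H | _] in FT *.
have Fc : cauchy F.
  apply/cauchy_rnormP => e e0; have e3 : 0 < e / 3 by rewrite divr_gt0.
  have [S cS TS] := h _ e3.
  move: cS; rewrite /compact_op precompactE compact_cover => cS.
  have ballE (z : H) (d : R) : ball z d%:C = [set y | rnorm (z - y) < d].
    by apply/seteqP; split => y; rewrite -ball_normE /ball_ /= rnormE ltcR.
  have [|z Sz|D' _ hD'] := cS H setT (fun z => ball z (e / 3)%:C).
  - by move=> z _; apply: ball_open; rewrite ltcR.
  - by exists z => //; rewrite ballE /= subrr rnorm0.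
  have cov y : closure (T @` B) y -> exists2 z, z \in D' & rnorm (z - y) < e.
    move=> cy; have : nbhs y (ball y (e / 3)%:C) by apply: nbhsx_ballx; rewrite ltcR.
    move=> /cy[_ [[x Bx <-]]]; rewrite ballE /= => yTx.
    have /hD'[z /= zD'] : closure (S @` B) (S x).
      by apply: subset_closure; exists x.
    rewrite ballE /= => zSx; exists z => //.
    have TSx : rnorm (S x - T x) <= e / 3.
      rewrite rnormBC (le_trans (bop_le (T - S) x))//.
      move: Bx; rewrite /B /= rnormE (lecR _ 1) => Bx.
      by rewrite -[leRHS]mulr1 ler_pM ?rnorm_ge0// ltW.
    have := rnorm_tri z (S x) y; have := rnorm_tri (S x) (T x) y.
    rewrite (rnormBC (T x)); lra.
  apply: contrapT => nF.
  have : F (\bigcap_(z in [set` D']) ~` [set y | rnorm (z - y) < e]).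
    apply: filter_bigI => z zD'.
    have [Fz|//] := in_ultra_setVsetC [set y | rnorm (z - y) < e] UF.
    by exfalso; apply: nF; exists z.
  move=> /(filterI FT)/filter_ex[y [/cov[z zD' zy]]] /(_ z zD').
  exact.
exists (lim F).
have Fp : F --> lim F by exact: cauchy_cvg.
split=> //; apply: (@closed_closure _ (T @` B)).
move=> V /Fp FV; exact: filter_ex (filterI FT FV).
Qed.

End Adjoint.

#[global] Existing Instance totally_filter.

Section PartialSums.
Context {I : choiceType}.
Implicit Types (A B : {fset I}).

Lemma partial_sumE (V : zmodType) (v : I -> V) A :
  partial_sum v A = \sum_(i <- A) v i.
Proof. by rewrite /partial_sum big_seq_fsetE. Qed.

Lemma partial_sumU (V : zmodType) (v : I -> V) A B : [disjoint A & B]%fset ->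
  partial_sum v (A `|` B)%fset = partial_sum v A + partial_sum v B.
Proof.
move=> dAB; rewrite !partial_sumE -big_cat; apply: perm_big.
apply: uniq_perm; rewrite ?fset_uniq// ?cat_uniq ?fset_uniq ?andbT /=.
  apply/hasPn => x xB; apply/negP => xA.
  by have /fdisjointP/(_ _ xA)/negP := dAB.
by move=> x; rewrite mem_cat inE.
Qed.

Lemma partial_sumDsub (V : zmodType) (v : I -> V) A B : (A `<=` B)%fset ->
  partial_sum v B = partial_sum v A + partial_sum v (B `\` A)%fset.
Proof.
move=> AB; rewrite -partial_sumU; last first.
  by apply/fdisjointP => x xA; rewrite inE xA.
by congr partial_sum; rewrite fsetUDl fsetDv fsetD0; apply/esym/fsetUidPr.
Qed.

Context {R : realType} {V : completeNormedModType R[i]}.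

Lemma cvg_partial_sumP (v : I -> V) :
  cvg (partial_sum v @ totally) <->
  forall e : R, 0 < e -> exists A, forall B, [disjoint A & B]%fset ->
    rnorm (partial_sum v B) < e.
Proof.
split.
  move=> /cvg_rnormP cv e e0; have e2 : 0 < e / 2 by rewrite divr_gt0.
  have [A _ hA] := cv _ e2; exists A => B dAB.
  have h1 := hA A (fsubset_refl _).
  have h2 := hA (A `|` B)%fset (fsubsetUl _ _).
  rewrite /= partial_sumU// in h1 h2.
  rewrite (_ : partial_sum v B = (lim (partial_sum v @ totally) - partial_sum v A)
    - (lim (partial_sum v @ totally) - (partial_sum v A + partial_sum v B))).
    by apply: le_lt_trans (rnormB _ _) _; rewrite (splitr e) ltrD.
  by rewrite opprB [RHS]addrC subrKA [RHS]addrC addKr.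
move=> h; apply: cauchy_cvg; apply/cauchy_rnormP => e /h[A hA].
exists (partial_sum v A); exists A => // B /= AB.
rewrite (partial_sumDsub v AB) opprD addNKr rnormN; apply: hA.
by apply/fdisjointP => x xA; rewrite inE xA.
Qed.

End PartialSums.

Section Gram.
Context {R : realType} {H : hilbertType R}.
Local Notation Re := (@complex.Re _).

Lemma sum_CS (I : Type) (r : seq I) (u v : I -> R) (a b : R) :
  0 <= a -> 0 <= b ->
  \sum_(i <- r) u i ^+ 2 <= a ^+ 2 -> \sum_(i <- r) v i ^+ 2 <= b ^+ 2 ->
  \sum_(i <- r) u i * v i <= a * b.
Proof.
move=> a0 b0; set A := \sum_(i <- r) _; set B := \sum_(i <- r) _.
set c := \sum_(i <- r) _ => Aa Bb.
have quad t : 0 <= A - 2 * t * c + t ^+ 2 * B.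
  rewrite (_ : A - _ + _ = \sum_(i <- r) (u i - t * v i) ^+ 2).
    by apply: sumr_ge0 => i _; exact: sqr_ge0.
  rewrite mulr_sumr mulr_sumr -sumrN -!big_split /=; apply: eq_bigr => i _; ring.
have A0 : 0 <= A by apply: sumr_ge0 => i _; exact: sqr_ge0.
have B0 : 0 <= B by apply: sumr_ge0 => i _; exact: sqr_ge0.
suff cAB : c ^+ 2 <= A * B.
  rewrite (le_trans (ler_norm _))// -ler_sqr ?nnegrE ?mulr_ge0//.
  by rewrite real_normK ?num_real// exprMn (le_trans cAB)// ler_pM.
have [Bz|Bnz] := eqVneq B 0.
  have [->|cnz] := eqVneq c 0; first by rewrite expr0n mulr_ge0.
  have := quad ((A + 1) / (2 * c)); rewrite Bz mulr0 addr0.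
  rewrite (_ : 2 * _ * c = A + 1); first lra.
  by field.
have := quad (c / B).
rewrite (_ : A - _ + _ = A - c ^+ 2 / B); last by field.
by rewrite subr_ge0 ler_pdivrMr// lt_neqAle eq_sym Bnz.
Qed.

Lemma gram_CS (I : Type) (r : seq I) (x y : I -> bop H) (a b : R) :
  0 <= a -> 0 <= b ->
  (forall h, \sum_(i <- r) rnorm (x i h) ^+ 2 <= a ^+ 2 * rnorm h ^+ 2) ->
  (forall h, \sum_(i <- r) rnorm (y i h) ^+ 2 <= b ^+ 2 * rnorm h ^+ 2) ->
  rnorm (\sum_(i <- r) adjoint (y i) * x i) <= a * b.
Proof.
move=> a0 b0 xa yb; apply: rnorm_bop_le; first exact: mulr_ge0.
move=> h; set G := \sum_(i <- r) _; set g := G h.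
have [->|g0] := eqVneq (rnorm g) 0; first by rewrite !mulr_ge0 ?rnorm_ge0.
have {}g0 : 0 < rnorm g by rewrite lt_neqAle eq_sym g0 rnorm_ge0.
rewrite -(ler_pM2r g0) -expr2 -Re_ipxx {1}/g sumbE ip_suml raddf_sum /=.
apply: (@le_trans _ _ (\sum_(i <- r) rnorm (x i h) * rnorm (y i g))).
  apply: ler_sum => i _. rewrite -adjointEr.
  rewrite (le_trans (ler_norm _))// (le_trans (Re_le_cmod _))//.
  exact: CauchySchwarz_ip.
rewrite [leRHS](_ : _ = (a * rnorm h) * (b * rnorm g)); last by ring.
apply: sum_CS; rewrite ?mulr_ge0 ?rnorm_ge0//.
  by rewrite exprMn.
by rewrite exprMn.
Qed.

Lemma gram_form (I : Type) (r : seq I) (x : I -> bop H) h :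
  \sum_(i <- r) rnorm (x i h) ^+ 2 =
  Re (ip ((\sum_(i <- r) adjoint (x i) * x i) h) h).
Proof.
rewrite sumbE ip_suml raddf_sum /=; apply: eq_bigr => i _.
by rewrite -adjointEr Re_ipxx.
Qed.

Lemma gram_form_le (I : Type) (r : seq I) (x : I -> bop H) h :
  \sum_(i <- r) rnorm (x i h) ^+ 2 <=
  rnorm (\sum_(i <- r) adjoint (x i) * x i) * rnorm h ^+ 2.
Proof.
rewrite gram_form (le_trans (ler_norm _))// (le_trans (Re_le_cmod _))//.
rewrite (le_trans (CauchySchwarz_ip _ _))// expr2 mulrA ler_wpM2r ?rnorm_ge0//.
exact: bop_le.
Qed.

Implicit Types (x y : int -> bop H).

Definition gram x (j : int) : bop H := adjoint (x j) * x j.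

Lemma gram_le x (S : bop H) (A : {fset int}) h :
  partial_sum (gram x) @ totally --> S ->
  \sum_(i <- A) rnorm (x i h) ^+ 2 <= rnorm S * rnorm h ^+ 2.
Proof.
move=> /cvg_rnormP cS; apply/ler_addgt0Pr => e e0.
have k0 : 0 < rnorm h ^+ 2 + 1 by rewrite ltr_wpDl// sqr_ge0.
have d0 : 0 < e / (rnorm h ^+ 2 + 1) by rewrite divr_gt0.
have [A0 _ hA0] := cS _ d0.
have AA : (A `<=` A `|` A0)%fset by exact: fsubsetUl.
have := hA0 (A `|` A0)%fset (fsubsetUr _ _); rewrite /= => hB.
move: (A `|` A0)%fset AA hB => B AB hB.
apply: (@le_trans _ _ (\sum_(i <- B) rnorm (x i h) ^+ 2)).
  rewrite -!partial_sumE (partial_sumDsub _ AB) lerDl partial_sumE.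
  by apply: sumr_ge0 => i _; exact: sqr_ge0.
rewrite (le_trans (gram_form_le _ _ _))//.
rewrite -[X in rnorm X * _]partial_sumE -/(gram x).
apply: (@le_trans _ _ ((rnorm S + rnorm (S - partial_sum (gram x) B)) * rnorm h ^+ 2)).
  rewrite ler_wpM2r ?sqr_ge0// -[X in rnorm X <= _](subKr S).
  by rewrite (le_trans (rnormB _ _)).
rewrite mulrDl lerD2l.
apply: (@le_trans _ _ (e / (rnorm h ^+ 2 + 1) * (rnorm h ^+ 2 + 1))).
  by rewrite ler_pM ?rnorm_ge0 ?sqr_ge0 ?lerDl// ltW.
by rewrite divfK// lt0r_neq0.
Qed.

End Gram.

Section Ell2.
Context {R : realType} {H : hilbertType R}.
Implicit Types (x y : int -> bop H).

(* The series of the positive operators x_j^* x_j converges in norm along the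
   finite subsets of int; for positive terms this is the same as convergence of
   the partial sums over {-N, ..., N}. *)
Definition in_ell2 : {pred int -> bop H} := [pred x : int -> bop H |
  `[< (forall j, compact_op (x j)) /\
      exists2 S, compact_op S & partial_sum (gram x) @ totally --> S >]].

Lemma in_ell2P x : reflect
  ((forall j, compact_op (x j)) /\ cvg (partial_sum (gram x) @ totally))
  (x \in in_ell2).
Proof.
apply: (iffP (asboolP _)) => [[xc [S _ cS]]|[xc cx]]; split => //.
  by apply/cvg_ex; exists S.
exists (lim (partial_sum (gram x) @ totally)) => //.
apply: compact_op_closed => e e0.
move/cvg_rnormP : cx => /(_ e e0)[A _ /(_ A (fsubset_refl _)) hA].
exists (partial_sum (gram x) A) => //.
by apply: compact_op_sum => i _; exact: compact_opMl.
Qed.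

Lemma in_ell2_cauchyP x : reflect
  ((forall j, compact_op (x j)) /\
    forall e : R, 0 < e -> exists A, forall B, [disjoint A & B]%fset ->
      forall h, \sum_(i <- B) rnorm (x i h) ^+ 2 <= e * rnorm h ^+ 2)
  (x \in in_ell2).
Proof.
apply: (iffP (in_ell2P _)) => -[xc xe]; split => //.
  move=> e e0; have [A hA] := (cvg_partial_sumP _).1 xe e e0.
  exists A => B /hA; rewrite partial_sumE => hB h.
  rewrite (le_trans (gram_form_le _ _ _))// ler_wpM2r ?sqr_ge0//.
  exact: ltW.
apply/cvg_partial_sumP => e e0; have e2 : 0 < e / 2 by rewrite divr_gt0.
have [A hA] := xe _ e2; exists A => B /hA hB; rewrite partial_sumE.
apply: (@le_lt_trans _ _ (Num.sqrt (e / 2) * Num.sqrt (e / 2))); last first.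
  by rewrite -expr2 sqr_sqrtr ?ltW// ltr_pdivrMr// mulr_natr mulr2n ltrDr.
by apply: gram_CS; rewrite ?sqrtr_ge0// => h; rewrite sqr_sqrtr// ltW.
Qed.

Lemma rnormD_sqr_le (u v : H) :
  rnorm (u + v) ^+ 2 <= 2 * (rnorm u ^+ 2 + rnorm v ^+ 2).
Proof.
have h := rnormD u v.
apply: (@le_trans _ _ ((rnorm u + rnorm v) ^+ 2)).
  by rewrite ler_sqr ?nnegrE ?addr_ge0 ?rnorm_ge0.
have := sqr_ge0 (rnorm u - rnorm v); rewrite sqrrB sqrrD; lra.
Qed.

Fact in_ell2_submod : submod_closed in_ell2.
Proof.
split.
  apply/in_ell2_cauchyP; split; first by move=> j; exact: compact_op0.
  move=> e e0; exists fset0 => B _ h; rewrite big1; first by rewrite mulr_ge0 ?sqr_ge0 ?(ltW e0).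
  by move=> i _; rewrite rnorm0 expr0n.
move=> a x y /in_ell2_cauchyP[xc xe] /in_ell2_cauchyP[yc ye].
apply/in_ell2_cauchyP; split.
  by move=> j; apply: compact_opD => //; exact: compact_opZ.
move=> e e0; have k0 : 0 < cmod a ^+ 2 + 1 by rewrite ltr_wpDl// sqr_ge0.
have d0 : 0 < e / 4 / (cmod a ^+ 2 + 1) by rewrite !divr_gt0.
have e4 : 0 < e / 4 by rewrite divr_gt0.
have [A hA] := xe _ d0; have [A' hA'] := ye _ e4.
exists (A `|` A')%fset => B; rewrite fdisjointUX => /andP[/hA hB /hA' hB'] h.
apply: (@le_trans _ _ (2 * (cmod a ^+ 2 * \sum_(i <- B) rnorm (x i h) ^+ 2 +
    \sum_(i <- B) rnorm (y i h) ^+ 2))).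
  rewrite mulr_sumr -big_split mulr_sumr; apply: ler_sum => i _ /=.
  by rewrite (le_trans (rnormD_sqr_le _ _))// rnormZ exprMn.
have {}hB : cmod a ^+ 2 * \sum_(i <- B) rnorm (x i h) ^+ 2 <= e / 4 * rnorm h ^+ 2.
  apply: (@le_trans _ _ ((cmod a ^+ 2 + 1) * (e / 4 / (cmod a ^+ 2 + 1) * rnorm h ^+ 2))).
    by rewrite ler_pM ?sqr_ge0 ?lerDl ?sumr_ge0// => i _; exact: sqr_ge0.
  by rewrite mulrA [_ * (_ / _)]mulrC divfK// lt0r_neq0.
have := hB' h; lra.
Qed.

HB.instance Definition _ := GRing.isSubmodClosed.Build R[i] (int -> bop H) in_ell2
  in_ell2_submod.

Record ell2 := Ell2 { ell2_seq :> int -> bop H; _ : ell2_seq \in in_ell2 }.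

HB.instance Definition _ := [isSub for ell2_seq].
HB.instance Definition _ := [Choice of ell2 by <:].
HB.instance Definition _ := [SubChoice_isSubLmodule of ell2 by <:].

Implicit Types (u v : ell2).

Lemma ell2DE u v j : (u + v) j = u j + v j.
Proof. by []. Qed.
Lemma ell2ZE a u j : (a *: u) j = a *: u j.
Proof. by []. Qed.
Lemma ell2_0E j : (0 : ell2) j = 0.
Proof. by []. Qed.

Definition ell2_norm u : R := Num.sqrt (rnorm (sum (gram u))).

Lemma ell2_cvg u : partial_sum (gram u) @ totally --> sum (gram u).
Proof. by have /in_ell2P[_] := valP u. Qed.

Lemma ell2_norm_ge0 u : 0 <= ell2_norm u.
Proof. exact: sqrtr_ge0. Qed.

Lemma ell2_norm_form u (A : {fset int}) h :
  \sum_(i <- A) rnorm (u i h) ^+ 2 <= ell2_norm u ^+ 2 * rnorm h ^+ 2.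
Proof. by rewrite sqr_sqrtr ?rnorm_ge0//; apply: gram_le; exact: ell2_cvg. Qed.

Lemma ell2_norm_le u (M : R) : 0 <= M ->
  (forall (A : {fset int}) h, \sum_(i <- A) rnorm (u i h) ^+ 2 <= M ^+ 2 * rnorm h ^+ 2) ->
  ell2_norm u <= M.
Proof.
move=> M0 uM; rewrite -ler_sqr ?nnegrE ?ell2_norm_ge0// sqr_sqrtr ?rnorm_ge0//.
apply/ler_addgt0Pr => e e0.
have /cvg_rnormP/(_ e e0)[A _ /(_ A (fsubset_refl _)) /= hA] := @ell2_cvg u.
rewrite -[X in rnorm X](subrK (partial_sum (gram u) A)) [leRHS]addrC.
rewrite (le_trans (rnormD _ _))// lerD//; first exact: ltW.
by rewrite partial_sumE; apply: gram_CS.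
Qed.

Lemma sum_sqrD_le (r : seq int) (f g : int -> H) (a b : R) : 0 <= a -> 0 <= b ->
  \sum_(i <- r) rnorm (f i) ^+ 2 <= a ^+ 2 ->
  \sum_(i <- r) rnorm (g i) ^+ 2 <= b ^+ 2 ->
  \sum_(i <- r) rnorm (f i + g i) ^+ 2 <= (a + b) ^+ 2.
Proof.
move=> a0 b0 fa gb; have fg := sum_CS a0 b0 fa gb.
apply: (@le_trans _ _ (\sum_(i <- r) (rnorm (f i) ^+ 2 +
    2 * (rnorm (f i) * rnorm (g i)) + rnorm (g i) ^+ 2))).
  apply: ler_sum => i _; rewrite mulrA mulr2n !mulrDl !mul1r -mulr2n -sqrrD.
  by rewrite ler_sqr ?nnegrE ?addr_ge0 ?rnorm_ge0 ?rnormD.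
rewrite !big_split /= -mulr_sumr sqrrD; lra.
Qed.

Fact ell2_normD u v : (ell2_norm (u + v))%:C <= (ell2_norm u)%:C + (ell2_norm v)%:C.
Proof.
rewrite -rmorphD lecR; apply: ell2_norm_le; first by rewrite addr_ge0 ?ell2_norm_ge0.
move=> A h; rewrite -exprMn mulrDl.
have nh (w : ell2) : 0 <= ell2_norm w * rnorm h by rewrite mulr_ge0 ?ell2_norm_ge0 ?rnorm_ge0.
have lh (w : ell2) : \sum_(i <- A) rnorm (w i h) ^+ 2 <= (ell2_norm w * rnorm h) ^+ 2.
  by rewrite exprMn; exact: ell2_norm_form.
exact: (@sum_sqrD_le A (fun i => u i h) (fun i => v i h) _ _ (nh u) (nh v) (lh u) (lh v)).
Qed.

Fact ell2_normZ (a : R[i]) u : (ell2_norm (a *: u))%:C = `|a| * (ell2_norm u)%:C.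
Proof.
rewrite cmodE -rmorphM; congr (_ %:C).
have h b v : ell2_norm (b *: v) <= cmod b * ell2_norm v.
  apply: ell2_norm_le; first by rewrite mulr_ge0 ?ell2_norm_ge0 ?cmod_ge0.
  move=> A x; rewrite exprMn -mulrA.
  apply: le_trans (ler_wpM2l (sqr_ge0 _) (ell2_norm_form v A x)).
  by rewrite mulr_sumr; apply: ler_sum => i _; rewrite ell2ZE scalebE rnormZ exprMn.
apply/eqP; rewrite eq_le h /=.
have [->|a0] := eqVneq a 0; first by rewrite cmod_real normr0 mul0r ell2_norm_ge0.
have ca : 0 < cmod a by rewrite -ltcR -cmodE normr_gt0.
rewrite mulrC -ler_pdivlMr// mulrC.
have -> : (cmod a)^-1 = cmod a^-1.
  apply: (mulfI (lt0r_neq0 ca)); rewrite -(cmodM a a^-1) divff; last exact: lt0r_neq0.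
  by rewrite divff// cmod_real normr1.
by have := h a^-1 (a *: u); rewrite scalerA mulVf// scale1r.
Qed.

Fact ell2_norm0_eq0 u : (ell2_norm u)%:C = 0 -> u = 0.
Proof.
move=> /complexI u0; apply/val_inj/funext => j /=; apply: bopP => h.
have := ell2_norm_form u [fset j]%fset h; rewrite u0 expr0n mul0r big_seq_fset1.
move=> hh; apply: rnorm0_eq0; apply/eqP.
by rewrite -sqrf_eq0 eq_le hh sqr_ge0.
Qed.

HB.instance Definition _ := Lmodule_isNormed.Build R[i] ell2
  ell2_normD ell2_normZ ell2_norm0_eq0.

Lemma rnorm_ell2 u : rnorm u = Num.sqrt (rnorm (sum (gram u))).
Proof. by []. Qed.

Definition wshift_seq (U : bop H) (W : int -> bop H) x : int -> bop H :=
  fun n => W n * x (n - 1) * U.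

Lemma wshift_subproof (U : bop H) (W : int -> bop H) u :
  (exists M : R, forall j, rnorm (W j) <= M) -> wshift_seq U W u \in in_ell2.
Proof.
move=> [M WM]; have M0 : 0 <= M := le_trans (rnorm_ge0 _) (WM 0).
have /in_ell2_cauchyP[uc ue] := valP u; apply/in_ell2_cauchyP; split.
  by move=> j; apply/compact_opMr/compact_opMl/uc.
move=> e e0; pose k := M ^+ 2 * rnorm U ^+ 2 + 1.
have k0 : 0 < k by rewrite ltr_wpDl// mulr_ge0 ?sqr_ge0.
have d0 : 0 < e / k by rewrite divr_gt0.
have [A hA] := ue _ d0; exists [fset (j + 1)%R | j in A]%fset => B dB h.
pose B' := [fset (j - 1)%R | j in B]%fset.
have dB' : [disjoint A & B']%fset.
  apply/fdisjointP => j jA; apply/imfsetP => -[i /= iB ji].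
  have iA : i \in [fset (j + 1)%R | j in A]%fset.
    by apply/imfsetP; exists j => //=; rewrite ji subrK.
  by have /fdisjointP/(_ i iA) := dB; rewrite iB.
have := hA _ dB' (U h); rewrite big_imfset /=; last by move=> i j _ _ /addIr.
move=> hU.
apply: (@le_trans _ _ (M ^+ 2 * \sum_(i <- B) rnorm (u (i - 1) (U h)) ^+ 2)).
  rewrite mulr_sumr; apply: ler_sum => i _; rewrite -exprMn ler_sqr ?nnegrE ?mulr_ge0 ?rnorm_ge0//.
  by apply: le_trans (bop_le (W i) (u (i - 1) (U h))) _; rewrite ler_wpM2r ?rnorm_ge0.
apply: (le_trans (ler_wpM2l (sqr_ge0 M) hU)).
apply: (@le_trans _ _ (M ^+ 2 * (e / k * (rnorm U * rnorm h) ^+ 2))).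
  rewrite ler_wpM2l ?sqr_ge0// ler_wpM2l ?(ltW d0)// ler_sqr ?nnegrE ?mulr_ge0 ?rnorm_ge0//.
  exact: bop_le.
rewrite (_ : _ * (_ * _) = e / k * (M ^+ 2 * rnorm U ^+ 2) * rnorm h ^+ 2); last by ring.
rewrite ler_wpM2r ?sqr_ge0// mulrAC ler_pdivrMr// ler_pM2l// /k lerDl//.
Qed.

(* wshift_seq U W u is in ell2 as soon as W is uniformly bounded (wshiftE); the
   default value 0 is then not used. *)
Definition wshift (U : bop H) (W : int -> bop H) u : ell2 :=
  insubd 0 (wshift_seq U W u).

Lemma wshiftE (U : bop H) (W : int -> bop H) u n :
  (exists M : R, forall j, rnorm (W j) <= M) ->
  wshift U W u n = W n * u (n - 1) * U.
Proof.
move=> bW; suff : val (wshift U W u) = wshift_seq U W u by move=> /(congr1 (@^~ n)).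
by rewrite insubdK//; exact: wshift_subproof.
Qed.

End Ell2.

Arguments ell2 {R} H.
Arguments in_ell2 {R} H.

Definition sym_range (J : nat) : set int := [set j | (`|j| <= J)%N].

Lemma sym_rangeE (J : nat) :
  sym_range J = [set` [seq (k%:Z - J%:Z)%R | k <- iota 0 J.*2.+1]].
Proof.
apply/seteqP; split => [j jJ|j].
  rewrite /sym_range /= in jJ; apply/mapP; exists (absz (j + J%:Z)%R).
    rewrite mem_iota; lia.
  lia.
by move=> /mapP[k]; rewrite mem_iota /sym_range /=; lia.
Qed.

Section OrthonormalBasis.
Context {R : realType} {H : hilbertType R}.
Implicit Types (e : int -> H) (D : set int) (L : set H).

Definition lin_span e D : set H := [set x | exists (s : seq int) (c : int -> R[i]),
  (forall i, i \in s -> D i) /\ x = \sum_(i <- s) c i *: e i].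

Definition orthonormal_basis e :=
  (forall i j, ip (e i) (e j) = (i == j)%:R) /\ dense (lin_span e setT).

(* The orthogonal projection onto a closed subspace L, characterized by
   P x \in L and x - P x orthogonal to L; the default value 0 is not used for the
   finite-dimensional L below, see orthoproj_lin_span. *)
Definition orthoproj L : bop H :=
  xget 0 [set P : bop H | forall x, L (P x) /\ forall y, L y -> ip (x - P x) y = 0].

Fact rank1_subproof (f : H) : (fun x => ip x f *: f) \in bounded_op H.
Proof.
apply/bounded_opP; split.
  by move=> a x y; rewrite ipDl ipZl scalerDl scalerA.
exists (rnorm f ^+ 2) => x; rewrite rnormZ expr2 [leRHS]mulrC mulrA.
by rewrite ler_wpM2r ?rnorm_ge0// CauchySchwarz_ip.
Qed.

Definition rank1 (f : H) : bop H := Bop (rank1_subproof f).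

Lemma orthoproj_lin_span e (s : seq int) :
  (forall i j, ip (e i) (e j) = (i == j)%:R) -> uniq s ->
  orthoproj (lin_span e [set` s]) = \sum_(i <- s) rank1 (e i).
Proof.
move=> oe us; set L := lin_span e _; set Q := \sum_(i <- s) _.
have QE x : Q x = \sum_(i <- s) ip x (e i) *: e i by rewrite sumbE.
have LQ x : L (Q x) by exists s, (fun i => ip x (e i)); rewrite -QE; split.
have oQ x y : L y -> ip (x - Q x) y = 0.
  move=> [r [c [rs ->]]]; rewrite ip_sumr big_seq big1// => i ir.
  have {ir}is_ : i \in s := rs i ir.
  rewrite ipZr ipBl QE ip_suml (bigD1_seq i) //= ipZl oe eqxx mulr1.
  rewrite big1 ?addr0 ?subrr ?mulr0// => k ki.
  by rewrite ipZl oe (negbTE ki) mulr0.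
have LB x y : L x -> L y -> L (x - y).
  move=> [r [c [rs ->]]] [r' [c' [rs' ->]]].
  have cs (r0 : seq int) (c0 : int -> R[i]) : (forall i, i \in r0 -> [set` s] i) ->
      \sum_(i <- r0) c0 i *: e i =
      \sum_(i <- s) (\sum_(k <- r0 | k == i) c0 k) *: e i.
    move=> r0s; under [RHS]eq_bigr do rewrite scaler_suml.
    rewrite (exchange_big_dep xpredT) //= big_seq [RHS]big_seq.
    apply: eq_bigr => k kr0; rewrite -big_filter.
    rewrite (_ : [seq i <- s | k == i] = [:: k]) ?big_seq1//.
    by rewrite (eq_filter (a2 := pred1 k)) ?filter_pred1_uniq ?r0s// => i /=; rewrite eq_sym.
  rewrite (cs r c rs) (cs r' c' rs') -sumrB; exists s, (fun i => \sum_(k <- r | k == i) c k -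
    \sum_(k <- r' | k == i) c' k); split => //.
  by apply: eq_bigr => i _; rewrite scalerBl.
rewrite /orthoproj; case: xgetP => [P _ hP|/(_ Q)]; last first.
  by move=> noQ; exfalso; apply: noQ => x; split; [exact: LQ|exact: oQ].
apply: bopP => x; have [LP oP] := hP x.
have LPQ := LB _ _ LP (LQ x).
apply/eqP; rewrite -subr_eq0 -normr_eq0 -sqrf_eq0 -ipxx.
rewrite -{1}(subrK x (P x)) -addrA ipDl -(opprB x) ipNl oP// oppr0 add0r.
by rewrite oQ.
Qed.

Lemma orthoproj_sym_range e (m : nat) :
  (forall i j, ip (e i) (e j) = (i == j)%:R) ->
  orthoproj (lin_span e (sym_range m)) =
  \sum_(k < m.*2.+1) rank1 (e (k%:Z - m%:Z)).
Proof.
move=> oe; rewrite sym_rangeE orthoproj_lin_span//; last first.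
  by rewrite map_inj_uniq ?iota_uniq// => i j /addIr[].
by rewrite big_map -(big_mkord xpredT (fun k => rank1 (e (k%:Z - m%:Z)))) /index_iota subn0.
Qed.

End OrthonormalBasis.

Definition furstenberg (F : set (set nat)) :=
  forall A B : set nat, F A -> A `<=` B -> F B.

Definition furstenberg_proper (F : set (set nat)) := F !=set0 /\ ~ F set0.

Definition finitely_invariant (F : set (set nat)) :=
  forall (A : set nat) (n : nat), F A -> F (A `\` [set k | (k <= n)%N]).

(* Sequences are indexed by n >= 1; the value at n = 0 is ignored. *)
Definition F_transitive (F : set (set nat)) (X : topologicalType)
    (T : nat -> X -> X) :=
  forall V1 V2 : set X, open V1 -> V1 !=set0 -> open V2 -> V2 !=set0 ->
    F [set n | (0 < n)%N /\ (T n @` V1) `&` V2 !=set0].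

Definition F_cvg_uniformly (F : set (set nat)) (I : Type) (D : set I)
    (X : I -> topologicalType) (x : forall i, nat -> X i) (l : forall i, X i) :=
  forall V : forall i, set (X i), (forall i, D i -> nbhs (l i) (V i)) ->
    exists2 A : set nat, F A &
      forall i, D i -> A `<=` [set n | (0 < n)%N /\ V i (x i n)].

(* Main.v *)
(** The iterates of the shift satisfy
    [(T^n x)_i = W_i ... W_(i-n+1) x_(i-n) U^n], and right multiplication by powers
    of [U] does not change norms.

    From transitivity to (2): let [x] have the entry [P_m] at the indices of [[J]] and
    [0] elsewhere.  A transition from [z] near [x] to a point near a large multiple
    [lam x] requires [t_n > 2J], so that the index windows [[J]], [[J] + t_n] and
    [[J] - t_n] do not overlap; then [D_j = z_j] and [G_j = lam^-1 (T^(t_n) z)_j] have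
    the required estimates.  Finite invariance allows the precision to be chosen
    diagonally in [n].

    From (2) to transitivity: by compactness [P_m x_j] is close to [x_j] for large
    [m], so [x] and [y] are approximated by the vectors with entries [D_j x_j] and
    [G_j y_j] on [[J]].  The sum of the former and of the preimage of the latter
    under [T^(t_n)] is near [x], and its image is near [y]. *)

Require Import Defs.
From HB Require Import structures.
From mathcomp Require Import all_boot all_order all_algebra.
From mathcomp Require Import finmap boolp classical_sets functions reals topology normedtype.
From mathcomp Require Import complex sesquilinear lra ring zify.

Set Implicit Arguments.
Unset Strict Implicit.
Unset Printing Implicit Defensive.
Import Order.TTheory GRing.Theory Num.Theory.
Import numFieldNormedType.Exports.
Local Open Scope classical_set_scope.
Local Open Scope ring_scope.
Local Open Scope complex_scope.

(** * Symmetric index windows as duplicate-free lists *)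

Section SymmetricRange.

Definition sym_seq (J : nat) : seq int := [seq k%:Z - J%:Z | k <- iota 0 J.*2.+1].

Lemma sym_seq_uniq J : uniq (sym_seq J).
Proof. by rewrite map_inj_uniq ?iota_uniq// => i j /addIr[]. Qed.

Lemma sym_seqP J j : reflect (sym_range J j) (j \in sym_seq J).
Proof. by rewrite sym_rangeE; exact: idP. Qed.

Lemma mem_sym_seq J j : (j \in sym_seq J) = (`|j| <= J)%N.
Proof. by apply/sym_seqP/idP. Qed.

Lemma sym_range_cover (s : seq int) : exists J0, forall J, (J0 <= J)%N ->
  {in s, forall j, (`|j| <= J)%N}.
Proof.
exists (\max_(j <- s) absz j) => J h j js; apply: leq_trans h.
by rewrite (big_rem j js) /= leq_maxl.
Qed.

End SymmetricRange.

(** * Operator norms under powers of a unitary operator *)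

Section UnitaryPowers.
Context {R : realType} {H : hilbertType R}.
Implicit Types (U T : bop H).

Lemma unitary_op_adjoint U : unitary_op U -> unitary_op (adjoint U).
Proof. by case=> h1 h2; split; rewrite adjointK. Qed.

Lemma unitary_rnorm U h : unitary_op U -> rnorm (U h) = rnorm h.
Proof.
case=> hU _; apply/eqP; rewrite -(eqrXn2 (n := 2)) ?rnorm_ge0// -!Re_ipxx.
by rewrite adjointE -mulbE hU onebE.
Qed.

Lemma unitary_exp_adjoint U n : unitary_op U -> U ^+ n * adjoint U ^+ n = 1.
Proof.
by case=> h1 h2; rewrite -exprMn_comm ?h2 ?expr1n// /GRing.comm h1 h2.
Qed.

Lemma rnorm_unitary_exp U n : unitary_op U -> rnorm (U ^+ n) <= 1.
Proof.
move=> hU; apply: rnorm_bop_le => // h; rewrite mul1r.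
elim: n => [|n IH]; first by rewrite expr0.
by rewrite exprS mulbE unitary_rnorm.
Qed.

Lemma rnorm_mul_unitary_exp U T n : unitary_op U -> rnorm (T * U ^+ n) <= rnorm T.
Proof.
move=> hU; rewrite (le_trans (rnormM _ _))// ler_piMr ?rnorm_ge0//.
exact: rnorm_unitary_exp.
Qed.

(** Multiplying on the right by [adjoint U ^+ n] recovers [T] from [T * U ^+ n], and the previous
    bound applies to [adjoint U], which is unitary too. *)
Lemma rnorm_le_mul_unitary_exp U T n : unitary_op U ->
  rnorm T <= rnorm (T * U ^+ n).
Proof.
move=> hU; rewrite -{1}[T]mulr1 -(unitary_exp_adjoint n hU) mulrA.
exact/rnorm_mul_unitary_exp/unitary_op_adjoint.
Qed.

End UnitaryPowers.

(** * Vectors supported at one index, and truncation to a window *)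

Section SingleCoordinate.
Context {R : realType} {H : hilbertType R}.
Implicit Types (u v : ell2 H) (K : bop H) (s : seq int) (c : int -> bop H).

Fact single_subproof j K : compact_op K ->
  (fun i : int => if i == j then K else 0) \in in_ell2 H.
Proof.
move=> cK; apply/in_ell2_cauchyP; split.
  by move=> i; case: ifP => // _; exact: compact_op0.
move=> e e0; exists [fset j]%fset => B dB h; rewrite big_seq big1.
  by rewrite mulr_ge0 ?sqr_ge0 ?(ltW e0).
move=> i iB; case: eqP => [ij|_]; last by rewrite zerobE rnorm0 expr0n.
by have /fdisjointP/(_ j) := dB; rewrite !inE eqxx -ij iB => /(_ isT).
Qed.

(* The default value 0 occurs only when K is not compact. *)
Definition single j K : ell2 H := insubd 0 (fun i : int => if i == j then K else 0).

Lemma singleE j K i : compact_op K -> single j K i = if i == j then K else 0.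
Proof.
move=> cK; suff : val (single j K) = (fun i : int => if i == j then K else 0).
  by move=> /(congr1 (@^~ i)).
by rewrite insubdK//; exact: single_subproof.
Qed.

Lemma ell2P u v : (forall j, u j = v j) -> u = v.
Proof. by move=> uv; apply/val_inj/funext. Qed.

Lemma ell2_sumE (I : Type) (r : seq I) (P : pred I) (E : I -> ell2 H) j :
  (\sum_(i <- r | P i) E i) j = \sum_(i <- r | P i) E i j.
Proof.
by apply: (big_ind2 (fun (u : ell2 H) (T : bop H) => u j = T)) => // u T v S <- <-.
Qed.

Lemma ell2_compact u j : compact_op (u j).
Proof. by have /in_ell2P[uc _] := valP u; exact: uc. Qed.

Lemma rnorm_ell2_le u (M : R) : 0 <= M ->
  (forall (A : {fset int}) h, \sum_(i <- A) rnorm (u i h) ^+ 2 <= M ^+ 2 * rnorm h ^+ 2) ->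
  rnorm u <= M.
Proof. exact: ell2_norm_le. Qed.

Lemma ell2_form_le u (A : {fset int}) h :
  \sum_(i <- A) rnorm (u i h) ^+ 2 <= rnorm u ^+ 2 * rnorm h ^+ 2.
Proof. exact: ell2_norm_form. Qed.

Lemma rnorm_coord_le u j : rnorm (u j) <= rnorm u.
Proof.
apply: rnorm_bop_le; first exact: rnorm_ge0.
move=> h; rewrite -ler_sqr ?nnegrE ?mulr_ge0 ?rnorm_ge0// exprMn.
by have := ell2_form_le u [fset j]%fset h; rewrite big_seq_fset1.
Qed.

Lemma rnorm_single_le j K : compact_op K -> rnorm (single j K) <= rnorm K.
Proof.
move=> cK; apply: rnorm_ell2_le; first exact: rnorm_ge0.
move=> A h; rewrite (eq_bigr (fun i => if i == j then rnorm (K h) ^+ 2 else 0)).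
  rewrite -big_mkcond /= big_const_seq /=.
  (* A finite set has no repetitions, so at most one term survives. *)
  have : (count (fun i : int => i == j) A <= 1)%N.
    by rewrite (count_uniq_mem _ (fset_uniq _)) leq_b1.
  case: count => [|[|//]] _ /=; first by rewrite mulr_ge0 ?sqr_ge0.
  by rewrite addr0 -exprMn ler_sqr ?nnegrE ?mulr_ge0 ?rnorm_ge0// bop_le.
by move=> i _; rewrite singleE//; case: ifP => // _; rewrite zerobE rnorm0 expr0n.
Qed.

Lemma sum_singleE s c i : uniq s -> (forall j, compact_op (c j)) ->
  (\sum_(j <- s) single j (c j)) i = if i \in s then c i else 0.
Proof.
move=> us cc; rewrite ell2_sumE.
rewrite (eq_bigr (fun j => if j == i then c i else 0)); last first.
  by move=> j _; rewrite singleE// eq_sym; case: eqP => // ->.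
rewrite -big_mkcond /= big_const_seq /= (count_uniq_mem _ us).
by case: (i \in s) => //=; rewrite addr0.
Qed.

(** The Cauchy criterion gives a finite set [A] off which all finite sums of squares are small,
    relative to the norm of [h]. Once the window contains [A], the remainder of [u] is supported off
    [A]. *)
Lemma ell2_truncation u (eps : R) : 0 < eps -> exists J0, forall J, (J0 <= J)%N ->
  rnorm (u - \sum_(j <- sym_seq J) single j (u j)) <= eps.
Proof.
move=> e0; have /in_ell2_cauchyP[uc ue] := valP u.
have [A hA] := ue _ (exprn_gt0 2 e0).
have [J0 hJ] := sym_range_cover A; exists J0 => J /hJ {}hJ.
set w := u - _.
have wE i : w i = if i \in sym_seq J then 0 else u i.
  transitivity (u i - (\sum_(j <- sym_seq J) single j (u j)) i) => //.
  rewrite sum_singleE ?sym_seq_uniq//.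
  by case: ifP => _; rewrite ?subrr ?subr0.
move: w wE => w wE; apply: rnorm_ell2_le (ltW e0) _ => B h.
apply: le_trans (hA [fset i in B | i \notin sym_seq J]%fset _ h).
  rewrite big_fset/= [leRHS]big_mkcond /=; apply: ler_sum => i _; rewrite wE.
  by case: (i \in _); rewrite // zerobE rnorm0 expr0n.
apply/fdisjointP => i /hJ iJ; apply/imfsetP => -[k] /[swap] <-.
by rewrite inE mem_sym_seq iJ andbF.
Qed.

End SingleCoordinate.

(** * Iterates of the weighted shift *)

Section IteratedShift.
Context {R : realType} {H : hilbertType R}.
Variables (U : bop H) (W : int -> bop H).
Hypothesis bW : exists M : R, forall j, rnorm (W j) <= M.
Implicit Types (u v : ell2 H) (K : bop H).

Local Notation Tn n := (iter n (wshift U W)).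

(** By induction: the outermost application contributes the leftmost weight [W i] and one factor [U]
    on the right, while the others are evaluated at [i - 1]. The order of the factors matters, since
    weights need not commute. *)
Lemma iter_wshiftE n u i :
  Tn n u i = (\prod_(k < n) W (i - k%:Z)) * u (i - n%:Z) * U ^+ n.
Proof.
elim: n i => [|n IH] i; first by rewrite big_ord0 subr0 expr0 mul1r mulr1.
rewrite iterS wshiftE// IH big_ord_recl subr0 exprSr !mulrA.
rewrite (_ : i - n.+1%:Z = i - 1 - n%:Z); last lia.
congr (_ * _ * _ * _ * _).
by apply: eq_bigr => k _; congr W; rewrite lift0; lia.
Qed.

Lemma iter_wshiftD n u v : Tn n (u + v) = Tn n u + Tn n v.
Proof.
apply: ell2P => i.
by rewrite iter_wshiftE ell2DE mulrDr mulrDl ell2DE !iter_wshiftE.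
Qed.

Lemma iter_wshift0 n : Tn n 0 = 0.
Proof. by apply: ell2P => i; rewrite iter_wshiftE !ell2_0E mulr0 mul0r. Qed.

Lemma iter_wshift_sum n (I : Type) (r : seq I) (E : I -> ell2 H) :
  Tn n (\sum_(i <- r) E i) = \sum_(i <- r) Tn n (E i).
Proof.
exact: (big_morph _ (iter_wshiftD n) (iter_wshift0 n)).
Qed.

Lemma iter_wshift_single n j K : compact_op K ->
  Tn n (single j K) =
  single (j + n%:Z) ((\prod_(k < n) W (j + n%:Z - k%:Z)) * K * U ^+ n).
Proof.
move=> cK; apply: ell2P => i; rewrite iter_wshiftE !singleE//; last first.
  exact/compact_opMr/compact_opMl.
rewrite subr_eq; case: eqP => [->//|_].
by rewrite mulr0 mul0r.
Qed.

(** The sum over [A] turns into a sum over the shifted set [B], taken at [U h] in place of [h], and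
    [U] preserves the norm of [h]. *)
Lemma rnorm_wshift_le (M : R) u : (forall j, rnorm (W j) <= M) ->
  unitary_op U -> rnorm (wshift U W u) <= M * rnorm u.
Proof.
move=> WM hU; have M0 : 0 <= M := le_trans (rnorm_ge0 _) (WM 0).
apply: rnorm_ell2_le; first by rewrite mulr_ge0 ?rnorm_ge0.
move=> A h; pose B := [fset (i - 1)%R | i in A]%fset.
apply: (@le_trans _ _ (\sum_(i <- A) M ^+ 2 * rnorm (u (i - 1) (U h)) ^+ 2)).
  apply: ler_sum => i _; rewrite wshiftE// !mulbE -exprMn.
  rewrite ler_sqr ?nnegrE ?mulr_ge0 ?rnorm_ge0//.
  by rewrite (le_trans (bop_le _ _))// ler_wpM2r ?rnorm_ge0.
rewrite -mulr_sumr exprMn -[leRHS]mulrA ler_wpM2l ?sqr_ge0//.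
have := ell2_form_le u B (U h); rewrite unitary_rnorm//.
by rewrite big_imfset //= => i j _ _ /addIr.
Qed.

Lemma rnorm_iter_wshift_le (M : R) n u : 0 <= M -> (forall j, rnorm (W j) <= M) ->
  unitary_op U -> rnorm (Tn n u) <= M ^+ n * rnorm u.
Proof.
move=> M0 WM hU; elim: n => [|n IH]; first by rewrite expr0 mul1r.
rewrite iterS (le_trans (rnorm_wshift_le _ WM hU))// exprS -mulrA.
exact: ler_wpM2l.
Qed.

End IteratedShift.

(** * Cancellation of weight products against inverse weights *)

Section InverseWeights.
Context {R : realType} {H : hilbertType R}.
Variables (W Wi : int -> bop H).
Hypothesis hWi : forall j, W j * Wi j = 1 /\ Wi j * W j = 1.

(** The factor split off is the inverse of [W (j - n)], the last factor of the direct product of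
    length [n.+1]; the two inductions below cancel this pair. *)
Lemma prod_inv_weightS n j :
  \prod_(k < n.+1) Wi (j - n.+1%:Z + 1 + k%:Z) =
  Wi (j - n%:Z) * \prod_(k < n) Wi (j - n%:Z + 1 + k%:Z).
Proof.
rewrite big_ord_recl; congr (Wi _ * _); first by rewrite /=; lia.
by apply: eq_bigr => k _; congr Wi; rewrite lift0; lia.
Qed.

Lemma prod_weight_inv n j :
  (\prod_(k < n) W (j - k%:Z)) * (\prod_(k < n) Wi (j - n%:Z + 1 + k%:Z)) = 1.
Proof.
elim: n => [|n IH]; first by rewrite !big_ord0 mulr1.
rewrite prod_inv_weightS big_ord_recr /=.
by rewrite mulrA -(mulrA _ (W _)) (proj1 (hWi _)) mulr1.
Qed.

Lemma prod_inv_weight n j :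
  (\prod_(k < n) Wi (j - n%:Z + 1 + k%:Z)) * (\prod_(k < n) W (j - k%:Z)) = 1.
Proof.
elim: n => [|n IH]; first by rewrite !big_ord0 mulr1.
rewrite prod_inv_weightS big_ord_recr /=.
by rewrite -mulrA (mulrA _ _ (W _)) IH mul1r (proj2 (hWi _)).
Qed.

End InverseWeights.

(** * Projections onto spans of basis vectors, and compact operators *)

Section SpanProjection.
Context {R : realType} {H : hilbertType R}.
Variable e : int -> H.
Hypothesis he : orthonormal_basis e.
Implicit Types (m : nat) (K : bop H).

Local Notation L m := (lin_span e (sym_range m)).
Local Notation P m := (orthoproj (L m)).

Let oe : forall i j, ip (e i) (e j) = (i == j)%:R := proj1 he.

Lemma sym_orthoprojE m : P m = \sum_(j <- sym_seq m) rank1 (e j).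
Proof. by rewrite sym_rangeE orthoproj_lin_span// sym_seq_uniq. Qed.

Lemma real_scale_continuous (f : H) : continuous (fun s : R => s%:C *: f).
Proof.
move=> s; apply/cvg_rnormP => d d0.
have k0 : 0 < rnorm f + 1 by rewrite ltr_wpDl// rnorm_ge0.
have : nbhs s (ball s (d / (rnorm f + 1))) by apply: nbhsx_ballx; rewrite divr_gt0.
apply: filterS => r; rewrite /ball /= => sr.
rewrite -scalerBl -rmorphB rnormZ cmod_real.
apply: (@le_lt_trans _ _ (`|s - r| * (rnorm f + 1))); first by rewrite ler_wpM2l ?lerDl.
by rewrite -ltr_pdivlMr.
Qed.

(** Splitting the coefficient into real and imaginary parts, both bounded by the norm of [f], places
    the image of the unit ball in the sum of two compact segments, along [f] and along ['i *: f]. *)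
Lemma compact_rank1 (f : H) : compact_op (rank1 f).
Proof.
pose c := rnorm f; pose I := [set` `[- c, c]%R] : set R.
have cI (g : H) : compact ((fun s : R => s%:C *: g) @` I).
  apply: continuous_compact; last exact: segment_compact.
  exact/continuous_subspaceT/real_scale_continuous.
have := compact_setX (cI f) (cI ('i *: f)); set K := _ `*` _ => cK.
apply: (@precompact_subset _ _ ((fun z : H * H => z.1 + z.2) @` K)); last first.
  apply: compact_precompact; first exact: norm_hausdorff.
  by apply: continuous_compact => //; apply: continuous_subspaceT; exact: add_continuous.
move=> _ [x /= x1 <-].
have ac : cmod (ip x f) <= c.
  rewrite (le_trans (CauchySchwarz_ip _ _))// ler_piMl ?rnorm_ge0//.
  by move: x1; rewrite rnormE (lecR _ 1).
exists ((complex.Re (ip x f))%:C *: f, (complex.Im (ip x f))%:C *: ('i *: f)).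
  split => /=.
    exists (complex.Re (ip x f)) => //; rewrite /I /= in_itv /= -ler_norml.
    exact: le_trans (Re_le_cmod _) ac.
  exists (complex.Im (ip x f)) => //; rewrite /I /= in_itv /= -ler_norml.
  apply: le_trans ac; have := Re_le_cmod ('i * ip x f); rewrite cmodM.
  have -> : cmod ('i : R[i]) = 1 by rewrite /cmod normCi.
  by rewrite mul1r; case: (ip x f) => a b /=; rewrite mul0r mul1r sub0r normrN.
rewrite /= scalerA -scalerDl; congr (_ *: _).
by rewrite [RHS]complexE mulrC.
Qed.

Lemma sym_orthoproj_compact m : compact_op (P m).
Proof. by rewrite sym_orthoprojE; apply: compact_op_sum => j _; exact: compact_rank1. Qed.

Lemma sym_orthoproj_basis m j : (`|j| <= m)%N -> P m (e j) = e j.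
Proof.
move=> jm; rewrite sym_orthoprojE sumbE (bigD1_seq j) ?mem_sym_seq ?sym_seq_uniq//=.
rewrite oe eqxx scale1r big1 ?addr0// => i ij.
by rewrite oe eq_sym (negbTE ij) scale0r.
Qed.

Lemma sym_orthoproj_id m y : L m y -> P m y = y.
Proof.
move=> [s [c [sm ->]]]; elim: s sm => [|j s IH] sm; first by rewrite big_nil bop0.
rewrite big_cons bopD bopZ IH => [|i is_]; last by apply: sm; rewrite inE is_ orbT.
by rewrite sym_orthoproj_basis//; apply: sm; rewrite inE eqxx.
Qed.

Lemma sym_orthoproj_adjoint m x y : ip (P m x) y = ip x (P m y).
Proof.
rewrite sym_orthoprojE !sumbE ip_suml ip_sumr; apply: eq_bigr => j _ /=.
by rewrite ipZl ipZr -ipC mulrC.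
Qed.

Lemma sym_orthoproj_in m x : L m (P m x).
Proof.
exists (sym_seq m), (fun j => ip x (e j)); split; first by move=> j /sym_seqP.
by rewrite sym_orthoprojE sumbE.
Qed.

(** Pythagoras: [x - P m x] is orthogonal to [L m], which contains [P m x - y]. *)
Lemma sym_orthoproj_best m x y : L m y -> rnorm (x - P m x) <= rnorm (x - y).
Proof.
have orth z : L m z -> ip (x - P m x) z = 0.
  by move=> /sym_orthoproj_id Pz; rewrite ipBl sym_orthoproj_adjoint Pz subrr.
move=> Ly; rewrite -ler_sqr ?nnegrE ?rnorm_ge0//.
have -> : x - y = (x - P m x) + (P m x - y) by rewrite addrA subrK.
rewrite [leRHS]rnormD2 ipBr !orth//; last exact: sym_orthoproj_in.
by rewrite subrr mulr0 addr0 lerDl sqr_ge0.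
Qed.

Lemma lin_span_subset (A B : set int) : A `<=` B -> lin_span e A `<=` lin_span e B.
Proof. by move=> AB x [s [c [sA ->]]]; exists s, c; split=> // i /sA /AB. Qed.

(** The open sets [O m] of points closer than [eps] to [L m] increase with [m] and cover the space,
    because the span of the basis is dense. By compactness one of them contains the image of the
    unit ball, and best approximation replaces the nearby point of [L m] by the projection. *)
Lemma sym_orthoproj_compact_cvg K (eps : R) : compact_op K -> 0 < eps ->
  exists m0, forall m, (m0 <= m)%N -> rnorm (K - P m * K) <= eps.
Proof.
move=> cK eps0; pose O (m : nat) := [set v : H | exists2 w, L m w & rnorm (v - w) < eps].
have Omono m m' : (m <= m')%N -> O m `<=` O m'.
  move=> mm v [w Lw vw]; exists w => //; apply: lin_span_subset Lw => j.
  by rewrite /sym_range /= => /leq_trans; apply.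
have Oopen m : open (O m).
  rewrite (_ : O m = \bigcup_(w in L m) ball w eps%:C).
    by apply: bigcup_open => w _; apply: ball_open; rewrite ltcR.
  apply/seteqP; split=> v [w Lw]; exists w => //; move: q;
    by rewrite -ball_normE /ball_ /= rnormE ltcR rnormBC.
have Ocover v : exists m, O m v.
  have [||w [bw [s [c [_ ws]]]]] := proj2 he (ball v eps%:C).
  - by exists v; apply: ballxx; rewrite ltcR.
  - by apply: ball_open; rewrite ltcR.
  have [m hm] := sym_range_cover s; exists m, w.
    by exists s, c; split=> // i /(hm _ (leqnn _)).
  by move: bw; rewrite -ball_normE /ball_ /= rnormE ltcR.
move: cK; rewrite /compact_op precompactE compact_cover => cK.
have [//|v _|D _ hD] := cK nat setT O.
  by have [m Om] := Ocover v; exists m.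
(* As [O] is increasing, the largest index of the finite subcover serves for the whole image. *)
exists (\max_(i <- D) i) => m Dm; rewrite rnorm_opnorm.
apply: ge_sup; first by case: (opnorm_has_sup (K - P m * K)).
move=> _ [h /= h1 <-].
have [i /= iD Oi] : cover [set` D] O (K h).
  by apply/hD/subset_closure; exists h => //=; rewrite rnormE (lecR _ 1).
have [w Lw Kw] : O m (K h).
  by apply: Omono Oi; apply: leq_trans Dm; rewrite (big_rem i iD) /= leq_maxl.
exact: le_trans (sym_orthoproj_best _ Lw) (ltW Kw).
Qed.

End SpanProjection.

(** * Diagonal selection, and neighborhoods of the origin in the space of quadruples *)

(** For each [n], [g n] realizes the highest precision [k] up to [n] that can be attained, and by
    monotonicity all lower ones; [x0] serves when none can be attained. *)
Lemma diagonal_choice (T : Type) (x0 : T) (P : nat -> nat -> T -> Prop) :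
  (forall n k l x, (l <= k)%N -> P n k x -> P n l x) ->
  exists g : nat -> T, forall n k, (k <= n)%N -> (exists x, P n k x) -> P n k (g n).
Proof.
move=> Pmono; suff /choice[g gP] : forall n, exists x, forall k, (k <= n)%N ->
    (exists y, P n k y) -> P n k x by exists g.
(* Only the bound on the precision is generalized to [N]; the index [n] stays fixed in the
   induction. *)
move=> n; move: {1}n => N; elim: N => [|N [x IH]].
  have [[x Px]|nP] := pselect (exists x, P n 0%N x).
    by exists x => k; rewrite leqn0 => /eqP->.
  by exists x0 => k; rewrite leqn0 => /eqP-> /nP.
have [[y Py]|nP] := pselect (exists y, P n N.+1 y).
  by exists y => k kN _; exact: Pmono Py.
by exists x => k; rewrite leq_eqVlt => /predU1P[-> /nP//|]; exact: IH.
Qed.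

Section Quadruples.
Context {R : realType}.

Lemma nbhs0_box (V : set (R * R * R * R)) : nbhs (0, 0, 0, 0) V ->
  exists2 d : R, 0 < d & forall a b c f,
    `|a| < d -> `|b| < d -> `|c| < d -> `|f| < d -> V (a, b, c, f).
Proof.
move=> /nbhs_ballP[d /= d0 dV]; exists d => // a b c f da db dc df; apply: dV.
by do ![split]; rewrite /ball /= sub0r normrN.
Qed.

(** Uniform convergence allows a different neighborhood at each index; as the window is finite, the
    least of the radii fits all of them. *)
Lemma nbhs0_box_uniform (s : seq int) (V : int -> set (R * R * R * R)) :
  (forall j, j \in s -> nbhs (0, 0, 0, 0) (V j)) ->
  exists2 d : R, 0 < d & forall j a b c f, j \in s ->
    `|a| < d -> `|b| < d -> `|c| < d -> `|f| < d -> V j (a, b, c, f).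
Proof.
elim: s => [|i s IH] sV; first by exists 1.
have [|d d0 dV] := IH; first by move=> j js; apply: sV; rewrite inE js orbT.
have [|d' d'0 d'V] := @nbhs0_box (V i); first by apply: sV; rewrite inE eqxx.
exists (Num.min d d'); first by rewrite lt_min d0.
move=> j a b c f; rewrite inE !lt_min => /predU1P[->|js]
  /andP[? ?] /andP[? ?] /andP[? ?] /andP[? ?]; [exact: d'V|exact: dV].
Qed.

Lemma box_nbhs0 (d : R) : 0 < d -> nbhs ((0, 0, 0, 0) : R * R * R * R)
  [set q | [/\ `|q.1.1.1| < d, `|q.1.1.2| < d, `|q.1.2| < d & `|q.2| < d]].
Proof.
move=> d0; apply/nbhs_ballP; exists d => //= -[[[a b] c] f] /= [[[]]].
by rewrite /ball /= !sub0r !normrN.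
Qed.

End Quadruples.

Lemma ball_rnormE {R : realType} (V : normedModType R[i]) (x : V) (d : R) :
  ball x d%:C = [set y | rnorm (x - y) < d].
Proof. by apply/seteqP; split => y; rewrite -ball_normE /ball_ /= rnormE ltcR. Qed.

Lemma open_rnorm_ball {R : realType} (V : normedModType R[i]) (A : set V) x :
  open A -> A x -> exists2 d : R, 0 < d & forall y, rnorm (x - y) < d -> A y.
Proof.
move=> oA Ax; have /nbhs_ballP[_ /gt0_complex[d d0 ->] dA] := open_nbhs_nbhs (conj oA Ax).
by exists d => // y xy; apply: dA; rewrite ball_rnormE.
Qed.

(** * From transitivity to the quadruples *)

Section TransitiveToQuadruples.
Context {R : realType} {H : hilbertType R}.
Variables (e : int -> H) (U : bop H) (W Wi : int -> bop H).
Hypothesis he : orthonormal_basis e.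
Hypothesis hU : unitary_op U.
Hypothesis hWi : forall j, W j * Wi j = 1 /\ Wi j * W j = 1.
Hypothesis hWb : exists M : R, forall j, rnorm (W j) <= M.
Variables J m : nat.

Local Notation P := (orthoproj (lin_span e (sym_range m))).
Local Notation Tn n := (iter n (wshift U W)).
Local Notation x := (\sum_(j <- sym_seq J) single j P).

Let xE i : x i = if i \in sym_seq J then P else 0.
Proof.
by rewrite (sum_singleE (c := fun=> P)) ?sym_seq_uniq// => _; exact: sym_orthoproj_compact.
Qed.

(* Applying T at most 2J times multiplies the norm by a bounded factor, so a
   large multiple of x is only reached from near x by higher powers of T. *)
Lemma large_multiple : exists2 lam : R, 1 <= lam & forall n z,
  rnorm (x - z) < 1 -> rnorm (lam%:C *: x - Tn n z) < 1 -> (J.*2 < n)%N.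
Proof.
(* With [M] at least 1, [M ^+ J.*2] dominates every lower power. *)
have [M0 WM0] := hWb; pose M := Num.max 1 M0.
have M1 : 1 <= M by rewrite le_max lexx.
have M0' : 0 <= M by rewrite (le_trans ler01).
have WM j : rnorm (W j) <= M by rewrite le_max WM0 orbT.
(* The entry of [x] at index 0 is the projection, which fixes the unit vector [e 0]. *)
have x1 : 1 <= rnorm x.
  have e1 : rnorm (e 0) = 1.
    apply/eqP; rewrite -(eqrXn2 (n := 2)) ?rnorm_ge0//.
    by rewrite -Re_ipxx (proj1 he) eqxx expr1n.
  have := bop_le P (e 0); rewrite sym_orthoproj_basis// e1 mulr1 => /le_trans; apply.
  by have := rnorm_coord_le x 0; rewrite xE mem_sym_seq.
(* The product bounds the norm of [Tn n z] when [n <= J.*2], since [z] has norm at most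
   [rnorm x + 1]; the added 1 then keeps [lam%:C *: x] at distance at least 1. *)
exists (M ^+ J.*2 * (rnorm x + 1) + 1).
  by rewrite lerDr mulr_ge0 ?exprn_ge0 ?addr_ge0 ?rnorm_ge0.
move=> n z xz; set lam := _ + 1; rewrite ltnNge; apply: contraL => nJ.
rewrite -leNgt.
have Tz : rnorm (Tn n z) <= lam - 1.
  rewrite /lam addrK (le_trans (rnorm_iter_wshift_le hWb _ _ M0' WM hU))//.
  rewrite ler_pM ?exprn_ge0 ?rnorm_ge0 ?ler_weXn2l//.
  rewrite -[z in leLHS](subKr x) (le_trans (rnormB _ _))// lerD2l; exact: ltW.
have lam0 : 0 <= lam.
  by rewrite addr_ge0 ?mulr_ge0 ?exprn_ge0 ?addr_ge0 ?rnorm_ge0.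
have lx : lam <= rnorm (lam%:C *: x).
  by rewrite rnormZ cmod_real ger0_norm// ler_peMr.
have TD := rnormD (lam%:C *: x - Tn n z) (Tn n z); rewrite subrK in TD.
rewrite -(lerD2r (rnorm (Tn n z))) (le_trans _ TD)// (le_trans _ lx)//.
by rewrite addrC -lerBrDr.
Qed.

(** Since [n] exceeds [J.*2], the indices [j + n] and [j - n] leave the window, where [x] vanishes.
    So [(Tn n z) (j + n)] is small, which is the third bound up to a unitary factor, and so is
    [z (j - n)], which the inverse weights recover from [(Tn n z) j]. Dividing by [lam >= 1] does
    not increase errors. *)
Lemma quadruple_bounds (lam d : R) n z j : 1 <= lam -> (J.*2 < n)%N ->
  rnorm (x - z) < d -> rnorm (lam%:C *: x - Tn n z) < d -> j \in sym_seq J ->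
  let G := lam^-1%:C *: (Tn n z) j in
  [/\ rnorm (z j - P) < d, rnorm (G - P) < d,
      rnorm ((\prod_(k < n) W (j + n%:Z - k%:Z)) * z j) < d &
      rnorm ((\prod_(k < n) Wi (j - n%:Z + 1 + k%:Z)) * G) < d].
Proof.
move=> lam1 Jn xz lxz js G.
have lam0 : 0 < lam by rewrite (lt_le_trans ltr01).
have lamV : cmod (lam^-1)%:C <= 1.
  by rewrite cmod_real ger0_norm ?invr_ge0 ?(ltW lam0)// invf_le1.
have cz i : rnorm (x i - z i) < d := le_lt_trans (rnorm_coord_le (x - z) i) xz.
have cT i : rnorm (lam%:C *: x i - Tn n z i) < d.
  exact: le_lt_trans (rnorm_coord_le (lam%:C *: x - Tn n z) i) lxz.
have shr (K : bop H) : rnorm ((lam^-1)%:C *: K) <= rnorm K.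
  by rewrite rnormZ ler_piMl ?rnorm_ge0.
have jJ : (`|j| <= J)%N by rewrite -mem_sym_seq.
split.
- by have := cz j; rewrite xE js rnormBC.
- have := cT j; rewrite xE js rnormBC; apply: le_lt_trans.
  rewrite (_ : G - P = (lam^-1)%:C *: (Tn n z j - lam%:C *: P)) ?shr//.
  by rewrite scalerBr scalerA -rmorphM mulVf ?lt0r_neq0// scale1r.
- have := cT (j + n%:Z); rewrite xE mem_sym_seq ifF; last by lia.
  rewrite scaler0 sub0r rnormN; apply: le_lt_trans.
  by rewrite iter_wshiftE// addrK rnorm_le_mul_unitary_exp.
- have := cz (j - n%:Z); rewrite xE mem_sym_seq ifF; last by lia.
  rewrite sub0r rnormN; apply: le_lt_trans.
  rewrite -scalerbAr (le_trans (shr _))// iter_wshiftE// !mulrA.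
  by rewrite (prod_inv_weight hWi) mul1r rnorm_mul_unitary_exp.
Qed.

Lemma quadruples_of_transitive (F : set (set nat)) (t : nat -> nat) :
  furstenberg F -> finitely_invariant F -> F_transitive F (fun n => Tn (t n)) ->
  exists D G : int -> nat -> bop H,
    (forall j n, sym_range J j -> compact_op (D j n) /\ compact_op (G j n)) /\
    F_cvg_uniformly F (sym_range J)
      (X := fun _ => (R * R * R * R)%type)
      (fun j n =>
        (rnorm (D j n - P), rnorm (G j n - P),
         rnorm ((\prod_(k < t n) W (j + (t n)%:Z - k%:Z)) * D j n),
         rnorm ((\prod_(k < t n) Wi (j - (t n)%:Z + 1 + k%:Z)) * G j n)))
      (fun _ => (0, 0, 0, 0)).
Proof.
move=> hF hFi tr; have [lam lam1 lamP] := large_multiple.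
(* [z] realizes the transition at time [n] with precision [k.+1%:R^-1]; the diagonal choice is made
   among these. *)
pose Q (n k : nat) (z : ell2 H) := rnorm (x - z) < k.+1%:R^-1 /\
  rnorm (lam%:C *: x - Tn (t n) z) < k.+1%:R^-1.
have [n k l z lk [h1 h2]|g gP] := @diagonal_choice _ 0 Q.
  have lk' : k.+1%:R^-1 <= l.+1%:R^-1 :> R by rewrite lef_pV2 ?posrE// ler_nat.
  by split; [exact: lt_le_trans h1 lk'|exact: lt_le_trans h2 lk'].
exists (fun j n => g n j), (fun j n => lam^-1%:C *: (Tn (t n) (g n)) j); split.
  by move=> j n _; split; [|apply: compact_opZ]; exact: ell2_compact.
move=> V VN.
have [j /sym_seqP js|d d0 dV] := @nbhs0_box_uniform R (sym_seq J) V; first exact: VN.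
have [k kd] : exists k, k.+1%:R^-1 < d.
  have [k] := ltr_add_invr d0; rewrite add0r; by exists k.
have k0 : 0 < k.+1%:R^-1 :> R by rewrite invr_gt0.
have k1 : k.+1%:R^-1 <= 1 :> R by rewrite invf_le1// ler1n.
pose N := [set n | (0 < n)%N /\ exists z, Q n k z].
have FN : F N.
  apply: hF (tr (ball x k.+1%:R^-1%:C) (ball (lam%:C *: x) k.+1%:R^-1%:C) _ _ _ _) _.
  - by apply: ball_open; rewrite ltcR.
  - by exists x; apply: ballxx; rewrite ltcR.
  - by apply: ball_open; rewrite ltcR.
  - by exists (lam%:C *: x); apply: ballxx; rewrite ltcR.
  - move=> n [n0 [_ [[z xz <-] lxz]]]; split=> //; exists z.
    by move: xz lxz; rewrite !ball_rnormE.
(* Removing the times up to [k] ensures [k <= n], so the diagonal vector [g n] has at least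
   precision [k]. *)
exists (N `\` [set l | (l <= k)%N]); first exact: hFi.
move=> j /sym_seqP js n [[n0 Qn] /negP]; rewrite -ltnNge => kn; split=> //.
have [h1 h2] := gP n k (ltnW kn) Qn.
have Jt := lamP _ _ (lt_le_trans h1 k1) (lt_le_trans h2 k1).
have [q1 q2 q3 q4] := quadruple_bounds lam1 Jt h1 h2 js.
have normd (r : R) : 0 <= r -> r < k.+1%:R^-1 -> `|r| < d.
  by move=> r0 rk; rewrite ger0_norm// (lt_trans rk).
by apply: dV => //; apply: normd => //; exact: rnorm_ge0.
Qed.

End TransitiveToQuadruples.

(** * From the quadruples to transitivity *)

Section QuadruplesToTransitive.
Context {R : realType} {H : hilbertType R}.
Variables (e : int -> H) (U : bop H) (W Wi : int -> bop H).
Hypothesis he : orthonormal_basis e.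
Hypothesis hU : unitary_op U.
Hypothesis hWi : forall j, W j * Wi j = 1 /\ Wi j * W j = 1.
Hypothesis hWb : exists M : R, forall j, rnorm (W j) <= M.
Implicit Types (u v : ell2 H) (D G P : int -> bop H).

Local Notation Tn n := (iter n (wshift U W)).
Local Notation iprod n j := (\prod_(k < n) Wi (j - n%:Z + 1 + k%:Z)).
Local Notation wprod n j := (\prod_(k < n) W (j + n%:Z - k%:Z)).

Lemma rnorm_sum_le (V : normedModType R[i]) (I : Type) (r : seq I) (E : I -> V) :
  rnorm (\sum_(i <- r) E i) <= \sum_(i <- r) rnorm (E i).
Proof.
apply: (big_ind2 (fun (a : V) b => rnorm a <= b)) => //; first by rewrite rnorm0.
by move=> a b c d ab cd; rewrite (le_trans (rnormD _ _))// lerD.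
Qed.

(** The second sum is built as the preimage of the entries [G j * v j]: the shift restores the
    index, the weights cancel their inverses and [U ^+ n] cancels [adjoint U ^+ n]. *)
Lemma iter_wshift_combination n (s : seq int) D G u v :
  Tn n (\sum_(j <- s) single j (D j * u j) +
        \sum_(j <- s) single (j - n%:Z) (iprod n j * G j * v j * adjoint U ^+ n)) =
  \sum_(j <- s) single j (G j * v j) +
  \sum_(j <- s) single (j + n%:Z) (wprod n j * D j * u j * U ^+ n).
Proof.
rewrite iter_wshiftD// !iter_wshift_sum// addrC; congr (_ + _).
  apply: eq_bigr => j _; rewrite iter_wshift_single//; last first.
    exact/compact_opMr/compact_opMl/ell2_compact.
  rewrite subrK; congr (single _ _).
  rewrite !mulrA (prod_weight_inv hWi) mul1r -mulrA.
  by have := unitary_exp_adjoint n (unitary_op_adjoint hU); rewrite adjointK => ->; rewrite mulr1.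
apply: eq_bigr => j _; rewrite iter_wshift_single ?mulrA//.
exact/compact_opMl/ell2_compact.
Qed.

(** One estimate serves both ends of the transition: [f] moves indices down by [t n] for the
    starting point and up by [t n] for its image, with [D] and [G] exchanged. *)
Lemma rnorm_sub_combination (s : seq int) (f : int -> int) (Q V : bop H)
    D (B : int -> bop H) u v (eta0 eta d : R) :
  0 <= d -> rnorm V <= 1 ->
  rnorm (u - \sum_(j <- s) single j (u j)) <= eta0 ->
  (forall j, j \in s -> [/\ rnorm (u j - Q * u j) <= eta,
     rnorm (D j - Q) <= d & rnorm (B j) <= d]) ->
  rnorm (u - (\sum_(j <- s) single j (D j * u j) +
              \sum_(j <- s) single (f j) (B j * v j * V))) <=
  eta0 + (eta + d * rnorm u + d * rnorm v) *+ size s.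
Proof.
move=> d0 V1 ueta sB.
(* The error carried by index [j]: a main term, compared through [Q * u j], and a displaced term
   made small by [B j]. *)
pose E j := single j (u j - D j * u j) - single (f j) (B j * v j * V).
have -> : u - (\sum_(j <- s) single j (D j * u j) +
      \sum_(j <- s) single (f j) (B j * v j * V)) =
    (u - \sum_(j <- s) single j (u j)) + \sum_(j <- s) E j.
  have -> : \sum_(j <- s) E j = \sum_(j <- s) single j (u j) -
      (\sum_(j <- s) single j (D j * u j) + \sum_(j <- s) single (f j) (B j * v j * V)).
    rewrite opprD addrA -!sumrB; apply: eq_bigr => j _; congr (_ - _).
    apply: ell2P => i; transitivity (single j (u j) i - single j (D j * u j) i) => //.
    have cu := ell2_compact u j; have cDu := compact_opMl (D j) cu.
    have cuDu : compact_op (u j - D j * u j).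
      by rewrite -scaleN1r; apply: compact_opD => //; exact: compact_opZ.
    by rewrite !singleE//; case: ifP; rewrite ?subr0.
  by rewrite addrA subrK.
rewrite (le_trans (rnormD _ _))// lerD//.
rewrite (le_trans (rnorm_sum_le _ _))//.
rewrite -iter_addr_0 -(count_predT s) -big_const_seq big_seq [leRHS]big_seq.
apply: ler_sum => j js; have [h1 h2 h3] := sB j js.
rewrite (le_trans (rnormB _ _))// lerD//.
  have cuDu : compact_op (u j - D j * u j).
    rewrite -scaleN1r; apply: compact_opD; first exact: ell2_compact.
    exact/compact_opZ/compact_opMl/ell2_compact.
  rewrite (le_trans (rnorm_single_le _ cuDu))//.
  rewrite (le_trans (rnorm_tri _ (Q * u j) _))// lerD// -mulrBl.
  rewrite (le_trans (rnormM _ _))// ler_pM ?rnorm_ge0 ?rnorm_coord_le//.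
  by rewrite rnormBC.
have cBV : compact_op (B j * v j * V) by exact/compact_opMr/compact_opMl/ell2_compact.
rewrite (le_trans (rnorm_single_le _ cBV))// (le_trans (rnormM _ _))//.
apply: (@le_trans _ _ (rnorm (B j * v j))); first by rewrite ler_piMr ?rnorm_ge0.
by rewrite (le_trans (rnormM _ _))// ler_pM ?rnorm_ge0 ?rnorm_coord_le.
Qed.

Lemma transitive_of_quadruples (F : set (set nat)) (t : nat -> nat) :
  furstenberg F ->
  (forall J m : nat, (0 < J)%N -> (0 < m)%N -> exists D G : int -> nat -> bop H,
    F_cvg_uniformly F (sym_range J)
      (X := fun _ => (R * R * R * R)%type)
      (fun j n =>
        (rnorm (D j n - orthoproj (lin_span e (sym_range m))),
         rnorm (G j n - orthoproj (lin_span e (sym_range m))),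
         rnorm (wprod (t n) j * D j n), rnorm (iprod (t n) j * G j n)))
      (fun _ => (0, 0, 0, 0))) ->
  F_transitive F (fun n => Tn (t n)).
Proof.
have lt4 (r : R) : 0 < r -> r + (r + r) < r * 4 by lra.
move=> hF quad V1 V2 oV1 [x xV1] oV2 [y yV2].
have [d1 d10 xV] := open_rnorm_ball oV1 xV1.
have [d2 d20 yV] := open_rnorm_ball oV2 yV2.
pose eps := Num.min d1 d2; have eps0 : 0 < eps by rewrite lt_min d10.
(* Error budget: [eta0] for truncation, and at most [eta0] each, summed over the window, for the
   projection and for the terms governed by [d]. The total [3 * eta0] is below [eps]. *)
pose eta0 := eps / 4; have eta00 : 0 < eta0 by rewrite divr_gt0.
have [Jx hJx] := ell2_truncation x eta00; have [Jy hJy] := ell2_truncation y eta00.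
have [J [J0 JxJ JyJ]] : exists J, [/\ (0 < J)%N, (Jx <= J)%N & (Jy <= J)%N].
  by exists (maxn Jx Jy).+1; split; rewrite // leqW ?leq_maxl ?leq_maxr.
pose s := sym_seq J.
have {}hJx : rnorm (x - \sum_(j <- s) single j (x j)) <= eta0 by exact: hJx.
have {}hJy : rnorm (y - \sum_(j <- s) single j (y j)) <= eta0 by exact: hJy.
have [l sl] : exists l, size s = l by exists (size s).
pose N : R := l.+1%:R; have N0 : 0 < N by [].
pose eta := eta0 / N; have eta_gt0 : 0 < eta by rewrite divr_gt0.
pose C := rnorm x + rnorm y + 1.
have C0 : 0 < C by rewrite ltr_wpDl// addr_ge0 ?rnorm_ge0.
pose d := eta / C; have d0 : 0 < d by rewrite divr_gt0.
have /choice[mx hmx] j := sym_orthoproj_compact_cvg he (ell2_compact x j) eta_gt0.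
have /choice[my hmy] j := sym_orthoproj_compact_cvg he (ell2_compact y j) eta_gt0.
have [m m0 ms] : exists2 m, (0 < m)%N &
    forall j, j \in s -> (mx j <= m)%N /\ (my j <= m)%N.
  exists (\max_(j <- s) maxn (mx j) (my j)).+1 => // j js.
  by apply/andP; rewrite -geq_max (big_rem j js) leqW// leq_maxl.
have [D [G DG]] := quad J m J0 m0.
have [A FA hA] := DG (fun=> _) (fun _ _ => box_nbhs0 d0).
have small (u v : ell2 H) : rnorm u + rnorm v + 1 = C ->
    eta0 + (eta + d * rnorm u + d * rnorm v) *+ size s < eps.
  move=> uv; rewrite sl; have dC : d * rnorm u + d * rnorm v <= eta.
    rewrite -mulrDr -[eta](divfK (lt0r_neq0 C0)) -/d ler_wpM2l ?(ltW d0)//.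
    by rewrite -uv lerDl.
  apply: (@le_lt_trans _ _ (eta0 + (eta + eta) * N)).
    rewrite lerD2l -mulr_natr -addrA ler_pM ?lerD2l//; last by rewrite /N ler_nat.
    by rewrite addr_ge0 ?(ltW eta_gt0)// addr_ge0// mulr_ge0 ?rnorm_ge0 ?(ltW d0).
  have -> : (eta + eta) * N = eta0 + eta0 by rewrite mulrDl divfK ?lt0r_neq0.
  have epsE : eta0 * 4 = eps by rewrite /eta0 divfK ?pnatr_eq0.
  by rewrite -epsE; exact: lt4.
apply: hF FA _ => n An.
(* Index 0 lies in every window. *)
have n0 : (0 < n)%N by have [] := hA 0 isT n An.
have bnd j : j \in s -> [/\ rnorm (D j n - orthoproj (lin_span e (sym_range m))) <= d,
    rnorm (G j n - orthoproj (lin_span e (sym_range m))) <= d,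
    rnorm (wprod (t n) j * D j n) <= d & rnorm (iprod (t n) j * G j n) <= d].
  move=> /sym_seqP js; have [_ []] := hA j js n An.
  by do 4!move=> /(le_lt_trans (ler_norm _))/ltW ?; split.
pose z := \sum_(j <- s) single j (D j n * x j) +
  \sum_(j <- s) single (j - (t n)%:Z) (iprod (t n) j * G j n * y j * adjoint U ^+ t n).
split=> //; exists (Tn (t n) z); split.
  exists z => //; apply: xV; apply: (@lt_le_trans _ _ eps); last by rewrite ge_min lexx.
  apply: le_lt_trans (small x y erefl).
  apply: (@rnorm_sub_combination s _ (orthoproj (lin_span e (sym_range m)))
    (adjoint U ^+ t n) (D^~ n) (fun j => iprod (t n) j * G j n)) => //.
  - exact: ltW.
  - exact/rnorm_unitary_exp/unitary_op_adjoint.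
  - move=> j js; have [h1 h2 h3 h4] := bnd j js.
    by split=> //; apply: hmx; case: (ms j js).
apply: yV; apply: (@lt_le_trans _ _ eps); last by rewrite ge_min lexx orbT.
rewrite iter_wshift_combination.
(* The same budget applies with [x] and [y] exchanged, as [C] is symmetric in them. *)
apply: (@le_lt_trans _ _ _ _ _ _ (small y x _)); last by rewrite /C (addrC (rnorm y)).
apply: (@rnorm_sub_combination s _ (orthoproj (lin_span e (sym_range m)))
  (U ^+ t n) (G^~ n) (fun j => wprod (t n) j * D j n)) => //.
- exact: ltW.
- exact: rnorm_unitary_exp.
- move=> j js; have [h1 h2 h3 h4] := bnd j js.
  by split=> //; apply: hmy; case: (ms j js).
Qed.

End QuadruplesToTransitive.

Theorem proposition3p8 (R : realType) (H : hilbertType R)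
    (e : int -> H) (he : orthonormal_basis e)
    (U : bop H) (hU : unitary_op U)
    (W Wi : int -> bop H)
    (hWi : forall j, W j * Wi j = 1 /\ Wi j * W j = 1)
    (hWb : exists M : R, forall j, rnorm (W j) <= M)
    (hWib : exists M : R, forall j, rnorm (Wi j) <= M)
    (F : set (set nat)) (hF : furstenberg F) (hFp : furstenberg_proper F)
    (hFi : finitely_invariant F)
    (t : nat -> nat)
    (ht : forall M : nat, exists n : nat, (0 < n)%N /\ (M < t n)%N) :
  F_transitive F (fun (n : nat) (x : ell2 H) => iter (t n) (wshift U W) x) <->
  forall J m : nat, (0 < J)%N -> (0 < m)%N ->
    exists D G : int -> nat -> bop H,
      (forall j n, sym_range J j -> compact_op (D j n) /\ compact_op (G j n)) /\
      F_cvg_uniformly F (sym_range J)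
        (X := fun _ => (R * R * R * R)%type)
        (fun j n =>
          (rnorm (D j n - orthoproj (lin_span e (sym_range m))),
           rnorm (G j n - orthoproj (lin_span e (sym_range m))),
           rnorm ((\prod_(k < t n) W (j + (t n)%:Z - k%:Z)) * D j n),
           rnorm ((\prod_(k < t n) Wi (j - (t n)%:Z + 1 + k%:Z)) * G j n)))
        (fun _ => (0, 0, 0, 0)).
Proof.
split=> [tr J m _ _|quad].
  exact: (quadruples_of_transitive he hU hWi hWb J m hF hFi tr).
apply: (transitive_of_quadruples he hU hWi hWb hF) => J m J0 m0.
by have [D [G [_ DG]]] := quad J m J0 m0; exists D, G.
Qed.
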